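(* Let $v$ be a smooth ($C^\infty$) vector field on a neighborhood of $0$ in $\mathbb{R}^3$, $\xi=(x,y,z)^T$, with vanishing divergence $\nabla\cdot v=0$, of the form $v(\xi)=N\xi+b(\xi)$ where $b(\xi)=O(|\xi|^2)$ and $$N=Dv(0)=\begin{pmatrix}0&1&0\\0&0&1\\0&0&0\end{pmatrix}.$$ Then for every integer $D\ge 2$ there exist a volume-preserving (i.e. with Jacobian determinant identically $1$), near-identity change of coordinates $\eta=\psi(\xi)=\xi+h(\xi)$ with $h(\xi)=O(|\xi|^2)$, and a polynomial $p$ in two variables containing only terms of degree $\ge 2$, such that in the new coordinates $\eta=(\eta_1,\eta_2,\eta_3)$ the vector field becomes $$\dot\eta = N\eta+\hat e_3\,p(\eta_1,\eta_2)+O(|\eta|^{D+1}),\qquad \hat e_3=(0,0,1)^T.$$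
   Context: The transformed vector field is $w(\eta)=D\psi(\psi^{-1}(\eta))\,v(\psi^{-1}(\eta))$. ''Up to terms of arbitrary degree'' means the equality holds modulo terms of order $|\eta|^{D+1}$, for any prescribed $D$. *)

(* Defs.v *)
From HB Require Import structures.
From mathcomp Require Import all_boot all_order all_algebra.
From mathcomp Require Import all_classical all_reals all_analysis.
From mathcomp Require mpoly.
Set Implicit Arguments. Unset Strict Implicit. Unset Printing Implicit Defensive.
Import Order.TTheory GRing.Theory Num.Theory.
Import numFieldNormedType.Exports.
Local Open Scope classical_set_scope.
Local Open Scope ring_scope.

Definition ev (R : realType) (i : 'I_3) : 'rV[R]_3 := delta_mx 0 i.

Definition partial (R : realType) (i : 'I_3) (f : 'rV[R]_3 -> 'rV[R]_3)
  : 'rV[R]_3 -> 'rV[R]_3 := fun x => 'D_(ev R i) f x.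

Definition iter_partial (R : realType) (s : seq 'I_3) (f : 'rV[R]_3 -> 'rV[R]_3)
  : 'rV[R]_3 -> 'rV[R]_3 := foldr (fun i g => partial i g) f s.

Definition smooth_on (R : realType) (U : set 'rV[R]_3) (f : 'rV[R]_3 -> 'rV[R]_3) :=
  forall (s : seq 'I_3) (x : 'rV[R]_3), U x ->
    (forall i : 'I_3, derivable (iter_partial s f) x (ev R i)) /\
    {for x, continuous (iter_partial s f)}.

Definition jacmx (R : realType) (f : 'rV[R]_3 -> 'rV[R]_3) (x : 'rV[R]_3) : 'M[R]_3 :=
  \matrix_(i < 3, j < 3) (partial j f x) 0 i.

Definition divergence (R : realType) (f : 'rV[R]_3 -> 'rV[R]_3) (x : 'rV[R]_3) : R :=
  \sum_(i < 3) (partial i f x) 0 i.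

(* action of a matrix on a (column) vector, written with row vectors *)
Definition app (R : realType) (M : 'M[R]_3) (x : 'rV[R]_3) : 'rV[R]_3 := (M *m x^T)^T.

Definition Nmat (R : realType) : 'M[R]_3 :=
  \matrix_(i < 3, j < 3) (if (j : nat) == i.+1 then 1 else 0).

Definition Oh_at0 (R : realType) (f : 'rV[R]_3 -> 'rV[R]_3) (k : nat) :=
  exists C e : R, 0 < e /\ forall x : 'rV[R]_3, `|x| < e -> `|f x| <= C * `|x| ^+ k.

Definition eval12 (R : realType) (p : mpoly.mpoly 2 R) (eta : 'rV[R]_3) : R :=
  mpoly.meval (fun i : 'I_2 => eta 0 (widen_ord (leqnSn 2) i)) p.

(* Main.v *)
(* Taylor's formula replaces v by a divergence-free polynomial field up to
   O(|x|^(D+1)), and the rest is algebra in R[x,y,z].  Suppose the field is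
   N x + e_3 p(x,y) + b with b of order k.  Conjugating by a map id + h + ...,
   with h of order k, adds the bracket [N, h] to it modulo order k + 1, so one
   looks for h with b + [N, h] = e_3 p'(x,y).  With L = y d_x + z d_y this forces
   h_2 = b_1 + L h_1 and h_3 = b_2 + L h_2, and div h = 0 becomes the single
   equation A h_1 = g for A = d_x + d_y L + d_z L^2.  Commuting derivatives past L
   gives A L^m = c_m L^m d_x + L^(m+1) (...) with c_m > 0, so A is onto because L
   is nilpotent in each degree.

   A divergence-free polynomial field h is a sum of fields f a, where a is a
   constant vector along which f is invariant: Hamiltonian fields of monomials
   are combinations of those of w(z) (x + t y)^d.  Each shear id + f a is a
   polynomial automorphism of Jacobian 1 with inverse id - f a, so no inverse
   function theorem is needed, and the composite of the shears realizes h to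
   leading order. *)
Require Import Defs.
From HB Require Import structures.
From mathcomp Require Import all_boot all_order all_algebra.
From mathcomp Require Import all_classical all_reals all_analysis.
From mathcomp Require mpoly.
From mathcomp Require Import ring lra zify.
Import Order.TTheory GRing.Theory Num.Theory.
Import numFieldNormedType.Exports.
Local Open Scope classical_set_scope.
Local Open Scope ring_scope.
Import -(notations) mpoly.
Set Implicit Arguments. Unset Strict Implicit. Unset Printing Implicit Defensive.

(** * Order of vanishing of a polynomial at the origin *)

Section OrderOfVanishing.
Variables (R : numFieldType) (n : nat).
Implicit Types (p q : mpoly n R) (m : multinom n) (i j : 'I_n) (k : nat).

(** The Jacobian must be identically 1, while [id + h] with [divg h = 0] has Jacobian 1 only to
    leading order; this forces the detour through shears, whose composites have Jacobian exactly 1.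
    Every conjugation is then an exact identity between polynomial fields: [Q] is the full
    pushforward of [P], never truncated, and orders only measure its distance to the normal form.
    Divergence 0 must survive each step too, because it makes the new term of the normal form
    independent of z; [volume_conjugacy] carries it along, and it is verified on shears. That h_1 is
    the only unknown of the homological equation comes from its triangular shape: the first two
    components give h_2 and h_3 without solving anything, and the third is not solved at all, since
    it defines p'. On the analytic side [smooth_on] provides only iterated partial derivatives along
    the axes, so the symmetry of second derivatives and Taylor's estimate are derived from the
    one-variable mean value theorem. *)

Definition order_ge k p := forall m, (mdeg m < k)%N -> mcoeff m p = 0.

Lemma order_ge0 k : order_ge k 0.
Proof. by move=> m _; rewrite mcoeff0. Qed.

Lemma order_geW k l p : (l <= k)%N -> order_ge k p -> order_ge l p.
Proof. by move=> lk pk m ml; apply: pk; apply: leq_trans lk. Qed.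

Lemma order_ge_any p : order_ge 0 p.
Proof. by []. Qed.

Lemma order_geD k p q : order_ge k p -> order_ge k q -> order_ge k (p + q).
Proof. by move=> pk qk m mk; rewrite mcoeffD pk ?qk ?addr0. Qed.

Lemma order_geN k p : order_ge k p -> order_ge k (- p).
Proof. by move=> pk m mk; rewrite mcoeffN pk ?oppr0. Qed.

Lemma order_geB k p q : order_ge k p -> order_ge k q -> order_ge k (p - q).
Proof. by move=> pk qk; apply: order_geD => //; apply: order_geN. Qed.

Lemma order_geZ k c p : order_ge k p -> order_ge k (c *: p).
Proof. by move=> pk m mk; rewrite mcoeffZ pk ?mulr0. Qed.

Lemma order_ge_sum k (I : Type) (r : seq I) (S : pred I) (F : I -> mpoly n R) :
  (forall x, S x -> order_ge k (F x)) -> order_ge k (\sum_(x <- r | S x) F x).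
Proof.
move=> Fk; elim/big_rec: _ => [|x p Sx pk]; first exact: order_ge0.
by apply: order_geD => //; apply: Fk.
Qed.

Lemma order_geX m : order_ge (mdeg m) (mpolyX R m).
Proof. by move=> m'; rewrite mcoeffX; case: eqP => // <-; rewrite ltnn. Qed.

Lemma order_geXU i : order_ge 1 (mpolyX R (mnm1 i)).
Proof. by move=> m; rewrite -(mdeg1 i); exact: order_geX. Qed.

Lemma order_geM k l p q :
  order_ge k p -> order_ge l q -> order_ge (k + l) (p * q).
Proof.
move=> pk ql m mkl; rewrite mcoeffM big1 // => -[m1 m2] /= /eqP em.
have : mdeg m = (mdeg m1 + mdeg m2)%N by rewrite -mdegD -em.
move=> mE.
have [m1k|m1k] := ltnP (mdeg m1) k; first by rewrite pk ?mul0r.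
by rewrite ql ?mulr0 //; lia.
Qed.

Lemma order_geMl k p q : order_ge k p -> order_ge k (p * q).
Proof. by move=> /order_geM /(_ (@order_ge_any q)); rewrite addn0. Qed.

Lemma order_geXn k e p : order_ge k p -> order_ge (k * e) (p ^+ e).
Proof.
move=> pk; elim: e => [|e IH]; first by rewrite muln0.
by rewrite exprS mulnS; apply: order_geM.
Qed.

Lemma order_ge_ind k (S : mpoly n R -> Prop) :
  S 0 -> (forall p q, S p -> S q -> S (p + q)) ->
  (forall c m, (k <= mdeg m)%N -> S (c *: mpolyX R m)) ->
  forall p, order_ge k p -> S p.
Proof.
move=> S0 SD SX p pk; rewrite [p]mpolyE big_seq.
elim/big_ind: _ => // m mp; apply: SX; rewrite leqNgt; apply/negP => /pk pm0.
by move: mp; rewrite mcoeff_msupp pm0 eqxx.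
Qed.

Lemma order_ge_mderiv k i p : order_ge k p -> order_ge k.-1 (mderiv i p).
Proof.
move=> pk m mk; rewrite mcoeff_mderiv pk ?mul0rn //.
by rewrite mdegD mdeg1; lia.
Qed.

Lemma order_ge_mderivS k i p : order_ge k.+1 p -> order_ge k (mderiv i p).
Proof. exact: order_ge_mderiv. Qed.

Lemma exists_antiderivative k i p : order_ge k p ->
  exists2 q, order_ge k.+1 q & mderiv i q = p.
Proof.
move: p; apply: order_ge_ind.
- by exists 0; [exact: order_ge0 | rewrite raddf0].
- move=> _ _ [p pk <-] [q qk <-]; exists (p + q); first exact: order_geD.
  by rewrite raddfD.
- move=> c m km; exists ((c / (m i).+1%:R) *: mpolyX R (mnm_add m (mnm1 i))).
    apply: order_geZ; apply: order_geW (@order_geX _).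
    by rewrite mdegD mdeg1 addn1.
  rewrite linearZ /= mderivX mnmDE mnm1E eqxx addn1 addmK scalerA.
  by rewrite divfK // pnatr_eq0.
Qed.

Lemma mpoly_ring_ind (S : mpoly n R -> Prop) :
  (forall c, S (mpolyC n c)) -> (forall i, S (mpolyX R (mnm1 i))) ->
  (forall p q, S p -> S q -> S (p + q)) -> (forall p q, S p -> S q -> S (p * q)) ->
  forall p, S p.
Proof.
move=> SC SX SD SM p; rewrite [p]mpolyE; elim/big_ind: _ => //.
  by rewrite -(mpolyC0 n); exact: SC.
move=> m _; rewrite -mul_mpolyC; apply: (SM) => //.
rewrite mpolyXE_id; elim/big_ind: _ => //; first by rewrite -mpolyC1; exact: SC.
move=> j _; elim: (m j) => [|e IH]; first by rewrite expr0 -mpolyC1; exact: SC.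
by rewrite exprS; exact: SM.
Qed.

End OrderOfVanishing.

(** * Substitution of polynomial maps: chain rule and order of the error *)

Section Substitution.
Variables (R : numFieldType) (n : nat).
Local Notation T := (mpoly n R).
Implicit Types (p q : T) (F G : 'rV[T]_n).

Definition idmap : 'rV[T]_n := \row_i mpolyX R (mnm1 i).

Local Notation subst F := (comp_mpoly [tuple F 0 j | j < n]).

(* Row [i] collects the [i]-th partial derivatives, so the differential of [F]
   acts on row vectors by right multiplication. *)
Definition jactr F : 'M[T]_n := \matrix_(i, j) mderiv i (F 0 j).

Definition divg F : T := \sum_i mderiv i (F 0 i).

Lemma mderivXU i j : mderiv i (mpolyX R (mnm1 j)) = (i == j)%:R :> T.
Proof.
rewrite mderivX mnm1E eq_sym; case: eqP => [->|_]; last by rewrite scale0r.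
by rewrite -{1}[mnm1 j]add0m addmK mpolyX0 scale1r.
Qed.

Lemma substXU F i : subst F (mpolyX R (mnm1 i)) = F 0 i.
Proof. by rewrite comp_mpolyXU -tnth_nth tnth_mktuple. Qed.

Lemma subst_unique (S : comNzRingType) (f g : {rmorphism T -> S}) :
  (forall c, f (mpolyC n c) = g (mpolyC n c)) ->
  (forall i, f (mpolyX R (mnm1 i)) = g (mpolyX R (mnm1 i))) -> f =1 g.
Proof.
move=> fgC fgX p; rewrite [p]mpolyE !raddf_sum; apply: eq_bigr => m _ /=.
rewrite -mul_mpolyC !rmorphM fgC; congr (_ * _).
rewrite mpolyXE_id !rmorph_prod; apply: eq_bigr => i _.
by rewrite !rmorphXn fgX.
Qed.

Lemma subst_comp F G p : subst G (subst F p) = subst (map_mx (subst G) F) p.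
Proof.
apply: (@subst_unique _ (comp_mpoly _ \o comp_mpoly _) (comp_mpoly _)) => [c|i].
  by rewrite /= !comp_mpolyC.
by rewrite /= !substXU mxE.
Qed.

Lemma subst_idmap p : subst idmap p = p.
Proof.
rewrite -[RHS]comp_mpoly_id; congr comp_mpoly.
by apply/eq_from_tnth => i; rewrite !tnth_mktuple mxE.
Qed.

Lemma mderiv_subst i F p :
  mderiv i (subst F p) = \sum_j subst F (mderiv j p) * mderiv i (F 0 j).
Proof.
move: p; apply: mpoly_ring_ind => [c|j|p1 p2 e1 e2|p1 p2 e1 e2].
- rewrite comp_mpolyC mderivC big1 // => j _.
  by rewrite mderivC raddf0 mul0r.
- rewrite substXU (bigD1 j) //= big1 ?addr0 => [|l lj].
    by rewrite mderivXU eqxx rmorph1 mul1r.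
  by rewrite mderivXU (negPf lj) raddf0 mul0r.
- rewrite !raddfD /= e1 e2 -big_split; apply: eq_bigr => j _.
  by rewrite !raddfD /= mulrDl.
- rewrite rmorphM mderivM /= e1 e2 big_distrl big_distrr.
  rewrite -big_split; apply: eq_bigr => j _ /=.
  rewrite mderivM raddfD /= !rmorphM /=; ring.
Qed.

Lemma jactr_subst F G :
  jactr (map_mx (subst G) F) = jactr G *m map_mx (subst G) (jactr F).
Proof.
apply/matrixP => i j; rewrite !mxE mderiv_subst; apply: eq_bigr => l _.
by rewrite !mxE mulrC.
Qed.

Lemma mderiv_idmap i j : mderiv i (idmap 0 j) = (i == j)%:R.
Proof. by rewrite mxE mderivXU. Qed.

Lemma jactr_idmap : jactr idmap = 1%:M.
Proof. by apply/matrixP => i j; rewrite mxE mderiv_idmap mxE. Qed.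

(* The error of a substitution close to the identity, of the order predicted by
   the mean value theorem; the exponents are shifted by one to avoid truncated
   subtractions. *)
Lemma order_ge_substB k l F p :
  (forall i, order_ge k.+1 (F 0 i - idmap 0 i)) ->
  order_ge l p -> order_ge (l + k) (subst F p - p).
Proof.
move=> Fk; move: p; apply: order_ge_ind => [|p q hp hq|c m lm].
- by rewrite raddf0 subr0; exact: order_ge0.
- by rewrite raddfD opprD addrACA; exact: order_geD.
rewrite linearZ /= -scalerBr; apply: order_geZ.
apply: (@order_geW _ _ (mdeg m + k)); first by rewrite leq_add2r.
have F1 i : order_ge 1 (F 0 i).
  rewrite -(subrK (idmap 0 i) (F 0 i)); apply: order_geD.
    by apply: order_geW (Fk i).
  by rewrite mxE; exact: order_geXU.
(* The two bounds are proved together: the error on a product is the error on one factor times the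
   other factor, whose order is needed as well. *)
have mul m1 m2 : order_ge (mdeg m1) (subst F (mpolyX R m1)) /\
    order_ge (mdeg m1 + k) (subst F (mpolyX R m1) - mpolyX R m1) ->
  order_ge (mdeg m2) (subst F (mpolyX R m2)) /\
    order_ge (mdeg m2 + k) (subst F (mpolyX R m2) - mpolyX R m2) ->
  order_ge (mdeg (mnm_add m1 m2)) (subst F (mpolyX R (mnm_add m1 m2))) /\
    order_ge (mdeg (mnm_add m1 m2) + k)
    (subst F (mpolyX R (mnm_add m1 m2)) - mpolyX R (mnm_add m1 m2)).
  move=> [s1 d1] [s2 d2]; rewrite mdegD mpolyXD rmorphM /=.
  split; first exact: order_geM.
  set A1 := comp_mpoly _ _ in s1 d1 *; set A2 := comp_mpoly _ _ in s2 d2 *.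
  have -> : A1 * A2 - mpolyX R m1 * mpolyX R m2 =
    (A1 - mpolyX R m1) * A2 + mpolyX R m1 * (A2 - mpolyX R m2) by ring.
  apply: order_geD; first by rewrite addnAC; exact: order_geM.
  by rewrite -addnA; apply: order_geM => //; exact: order_geX.
suff [] : order_ge (mdeg m) (subst F (mpolyX R m)) /\
    order_ge (mdeg m + k) (subst F (mpolyX R m) - mpolyX R m) by [].
have base0 : order_ge (mdeg (@mnm0 n)) (subst F (mpolyX R mnm0)) /\
    order_ge (mdeg (@mnm0 n) + k) (subst F (mpolyX R mnm0) - mpolyX R mnm0).
  rewrite mdeg0 mpolyX0 rmorph1 subrr; split => //; exact: order_ge0.
rewrite [m]multinomUE_id; elim/big_ind: _ => // i _.
elim: (m i) => [|e IH]; first by rewrite mulm0n.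
rewrite mulmS; apply: (mul) => //; rewrite mdeg1 substXU; split => //.
by rewrite add1n; have := Fk i; rewrite mxE.
Qed.

End Substitution.

(** * Polynomial automorphisms of Jacobian 1, and their effect on vector fields *)

Section VolumePreservingAutomorphisms.
Variables (R : numFieldType) (n : nat).
Local Notation T := (mpoly n R).
Local Notation subst F := (comp_mpoly [tuple F 0 j | j < n]).
Local Notation id_n := (idmap R n).
Implicit Types (p q f g h : T) (F G P Q Psi Phi : 'rV[T]_n) (a : 'rV[R]_n).

(** [conj_push] says that [Q] is the pushforward of [P] under [Psi], in row-vector form. [conj_div]
    is a field of the record because it passes to composites for free and can be computed directly
    for a shear; deducing it from [conj_det] would require differentiating a determinant. *)
Record volume_conjugacy (P Psi Phi Q : 'rV[T]_n) : Prop := VolumeConjugacy {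
  conj_left_inv : map_mx (subst Psi) Phi = id_n;
  conj_right_inv : map_mx (subst Phi) Psi = id_n;
  conj_det : \det (jactr Psi) = 1;
  conj_near_id : forall i, order_ge 2 (Psi 0 i - id_n 0 i);
  conj_inv_order : forall i, order_ge 1 (Phi 0 i);
  conj_push : P *m jactr Psi = map_mx (subst Psi) Q;
  conj_div : divg P = 0 -> divg Q = 0
}.

Lemma map_subst_comp m F G (A : 'M[T]_(m, n)) :
  map_mx (subst G) (map_mx (subst F) A) = map_mx (subst (map_mx (subst G) F)) A.
Proof. by apply/matrixP => i j; rewrite !mxE subst_comp. Qed.

Lemma map_subst_idmap m (A : 'M[T]_(m, n)) : map_mx (subst id_n) A = A.
Proof. by apply/matrixP => i j; rewrite !mxE subst_idmap. Qed.

Lemma map_subst_id F : map_mx (subst F) id_n = F.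
Proof. by apply/rowP => j; rewrite !mxE substXU. Qed.

(** The case of shift 0 in [order_ge_substB]: a map fixing the origin differs from the identity by
    terms of order 1. *)
Lemma order_ge_subst k F p : (forall i, order_ge 1 (F 0 i)) ->
  order_ge k p -> order_ge k (subst F p).
Proof.
move=> F1 pk; rewrite -(subrK p (subst F p)) -[X in order_ge X](addn0 k).
apply: order_geD; last by rewrite addn0.
apply: order_ge_substB => // i; apply: order_geB => //.
by rewrite mxE; exact: order_geXU.
Qed.

Lemma volume_conjugacy_refl P : volume_conjugacy P id_n id_n P.
Proof.
split; rewrite ?map_subst_idmap ?jactr_idmap ?det1 ?mulmx1 // => i.
  by rewrite subrr; exact: order_ge0.
by rewrite mxE; exact: order_geXU.
Qed.

Lemma volume_conjugacy_trans P Psi1 Phi1 Q Psi2 Phi2 S :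
  volume_conjugacy P Psi1 Phi1 Q -> volume_conjugacy Q Psi2 Phi2 S ->
  volume_conjugacy P (map_mx (subst Psi1) Psi2) (map_mx (subst Phi2) Phi1) S.
Proof.
move=> [l1 r1 d1 n1 o1 p1 v1] [l2 r2 d2 n2 o2 p2 v2]; split.
- by rewrite -map_subst_comp (map_subst_comp Phi2) l2 map_subst_idmap.
- by rewrite -map_subst_comp (map_subst_comp Psi1) r1 map_subst_idmap.
- by rewrite jactr_subst det_mulmx d1 mul1r det_map_mx d2 rmorph1.
- move=> i; rewrite mxE.
  rewrite -(subrK (Psi1 0 i) (comp_mpoly _ _)) -addrA; apply: order_geD => //.
  rewrite -(substXU Psi1 i) -rmorphB /=; apply: order_ge_subst.
    move=> j; rewrite -(subrK (id_n 0 j) (Psi1 0 j)); apply: order_geD.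
      exact: order_geW (n1 j).
    by rewrite mxE; exact: order_geXU.
  by have := n2 i; rewrite [id_n 0 i]mxE.
- by move=> i; rewrite mxE; exact: order_ge_subst.
- by rewrite jactr_subst mulmxA p1 -map_mxM p2 map_subst_comp.
- by move=> /v1.
Qed.

(* The two clauses are equivalent in characteristic 0; requiring both spares the
   proof of the equivalence. *)
Definition dird a f : T := \sum_i a 0 i *: mderiv i f.
Definition cst_row a : 'rV[T]_n := map_mx (@mpolyC n R) a.
Definition invariant_along a f :=
  dird a f = 0 /\ forall g, subst (id_n + g *: cst_row a) f = f.

Lemma dird_is_linear a : linear (dird a).
Proof.
move=> c p q; rewrite /dird scaler_sumr -big_split; apply: eq_bigr => i _ /=.
by rewrite linearP scalerDr !scalerA [c * _]mulrC.
Qed.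
HB.instance Definition _ a :=
  GRing.isLinear.Build R T T _ (dird a) (dird_is_linear a).

Lemma dirdM a p q : dird a (p * q) = dird a p * q + p * dird a q.
Proof.
rewrite /dird mulr_suml mulr_sumr -big_split; apply: eq_bigr => i _ /=.
by rewrite mderivM scalerDr scalerAl scalerAr.
Qed.

Lemma dird_mderiv a i p : dird a (mderiv i p) = mderiv i (dird a p).
Proof.
rewrite /dird raddf_sum; apply: eq_bigr => j _ /=.
by rewrite mderiv_comm linearZ.
Qed.

Lemma invariant_alongD a p q :
  invariant_along a p -> invariant_along a q -> invariant_along a (p + q).
Proof.
move=> [p0 ps] [q0 qs]; split=> [|g]; first by rewrite raddfD /= p0 q0 addr0.
by rewrite raddfD /= ps qs.
Qed.

Lemma invariant_alongM a p q :
  invariant_along a p -> invariant_along a q -> invariant_along a (p * q).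
Proof.
move=> [p0 ps] [q0 qs]; split=> [|g]; first by rewrite dirdM p0 q0 mul0r mulr0 addr0.
by rewrite rmorphM /= ps qs.
Qed.

Lemma invariant_alongC a c : invariant_along a (mpolyC n c).
Proof.
split=> [|g]; last by rewrite comp_mpolyC.
by rewrite /dird big1 // => i _; rewrite mderivC scaler0.
Qed.

Lemma invariant_alongZ a c p : invariant_along a p -> invariant_along a (c *: p).
Proof.
by move=> ap; rewrite -mul_mpolyC; apply: invariant_alongM => //; exact: invariant_alongC.
Qed.

Lemma invariant_alongXn a e p : invariant_along a p -> invariant_along a (p ^+ e).
Proof.
move=> ap; elim: e => [|e IH]; first by rewrite expr0 -mpolyC1; exact: invariant_alongC.
by rewrite exprS; exact: invariant_alongM.
Qed.

Lemma invariant_alongXU a i : a 0 i = 0 -> invariant_along a (mpolyX R (mnm1 i)).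
Proof.
move=> ai; split=> [|g].
  rewrite /dird big1 // => j _; rewrite mderivXU.
  by case: eqP => [->|_]; rewrite ?ai ?scale0r ?scaler0.
by rewrite substXU !mxE ai raddf0 mulr0 addr0.
Qed.

(* The Lie bracket [D h . P - D P . h] of vector fields. *)
Definition bracket (P h : 'rV[T]_n) : 'rV[T]_n := P *m jactr h - h *m jactr P.

Lemma bracketD P F G : bracket P (F + G) = bracket P F + bracket P G.
Proof.
have jD : jactr (F + G) = jactr F + jactr G.
  by apply/matrixP => i j; rewrite !mxE raddfD.
by rewrite /bracket jD mulmxDr mulmxDl opprD addrACA.
Qed.

Lemma jactr_shear f a :
  jactr (id_n + f *: cst_row a) = 1%:M + (\col_i mderiv i f) *m cst_row a.
Proof.
apply/matrixP => i j; rewrite -jactr_idmap !mxE big_ord1 !mxE raddfD /=.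
by rewrite mderivM mderivC mulr0 addr0.
Qed.

(** One block matrix, with rows [1, u] and [- w, 1], is factored in two ways into block triangular
    matrices. *)
Lemma det_rank1_update (A : comNzRingType) m (u : 'cV[A]_m) (w : 'rV[A]_m) :
  \det (1%:M + u *m w) = 1 + (w *m u) 0 0.
Proof.
have e1 : block_mx 1%:M u (- w) 1%:M =
    block_mx 1%:M 0 (- w) 1%:M *m block_mx 1%:M u 0 (1%:M + w *m u).
  rewrite mulmx_block !mul1mx ?mul0mx ?mulmx0 !mulmx1 !addr0.
  by rewrite mulNmx addrCA addNr addr0.
have e2 : block_mx 1%:M u (- w) 1%:M =
    block_mx (1%:M + u *m w) u 0 1%:M *m block_mx 1%:M 0 (- w) 1%:M.
  rewrite mulmx_block !mul1mx ?mul0mx ?mulmx0 !mulmx1 ?add0r.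
  by rewrite mulmxN addrK.
have : \det (block_mx 1%:M u (- w) (1%:M : 'M[A]_1)) = \det (1%:M + u *m w).
  by rewrite e2 det_mulmx det_ublock det_lblock !det1 !mulr1.
rewrite e1 det_mulmx det_ublock det_lblock !det1 !mul1r => <-.
by rewrite det_mx11 !mxE.
Qed.

(** The determinant is [1 + dird a f]. The delicate clause is [conj_div]: with [B = P + g a] and [S]
    the inverse shear, div (B o S) is the composite with [S] of [divg B] minus a correction, and
    both equal [dird a g] when [divg P = 0]. *)
Lemma volume_conjugacy_shear k P f a : (2 <= k)%N ->
  order_ge k f -> invariant_along a f ->
  volume_conjugacy P (id_n + f *: cst_row a) (id_n - f *: cst_row a)
   (map_mx (subst (id_n - f *: cst_row a))
      (P + (\sum_i P 0 i * mderiv i f) *: cst_row a)).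
Proof.
move=> k2 fk [f0 fs]; set ca := cst_row a; set g := \sum_i _.
have gcomp h c : map_mx (subst (id_n + c *: ca)) (h *: ca) =
    subst (id_n + c *: ca) h *: ca.
  by apply/rowP => j; rewrite !mxE rmorphM /= comp_mpolyC.
have invl (e : T) : subst (id_n + e *: ca) f = f -> 
    map_mx (subst (id_n + e *: ca)) (id_n - f *: ca) = id_n + (e - f) *: ca.
  by move=> ef; rewrite map_mxB map_subst_id gcomp ef scalerBl addrA.
have invr (e : T) : subst (id_n + e *: ca) f = f -> 
    map_mx (subst (id_n + e *: ca)) (id_n + f *: ca) = id_n + (e + f) *: ca.
  by move=> ef; rewrite map_mxD map_subst_id gcomp ef scalerDl addrA.
have mNf : id_n - f *: ca = id_n + (- f) *: ca by rewrite scaleNr.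
have pushE : P *m jactr (id_n + f *: ca) = P + g *: ca.
  rewrite jactr_shear mulmxDr mulmx1 mulmxA; congr (_ + _).
  by apply/rowP => j; rewrite !mxE big_ord1 !mxE; congr (_ * _);
    apply: eq_bigr => i _; rewrite !mxE.
have fca i : order_ge k ((f *: ca) 0 i) by rewrite !mxE; exact: order_geMl.
have idfca (s : bool) i : order_ge 1 ((id_n + (-1) ^+ s *: (f *: ca)) 0 i).
  rewrite mxE; apply: order_geD; first by rewrite mxE; exact: order_geXU.
  rewrite mxE mulrC; apply: order_geMl; apply: order_geW (fca i).
  exact: leq_trans k2.
have sidE : map_mx (subst (id_n + f *: ca)) (id_n - f *: ca) = id_n.
  by rewrite invl // subrr scale0r addr0.
split => //.
- by rewrite {1}mNf invr // addNr scale0r addr0.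
- rewrite jactr_shear det_rank1_update mxE.
  suff -> : \sum_j ca 0 j * (\col_i mderiv i f) j 0 = 0 by rewrite addr0.
  rewrite -[RHS]f0; apply: eq_bigr => i _.
  by rewrite !mxE mul_mpolyC.
- move=> i; rewrite mxE addrAC subrr add0r; exact: order_geW (fca i).
- by move=> i; have := idfca true i; rewrite expr1 scaleN1r.
- by rewrite pushE map_subst_comp sidE map_subst_idmap.
move=> divP; set S := id_n - f *: ca.
have Sf : subst S f = f by rewrite /S mNf.
(* Differentiate the identity [f o S = f]: the extra term of the chain rule contains the factor
   [dird a f = 0]. *)
have dSf j : subst S (mderiv j f) = mderiv j f.
  rewrite -[in RHS]Sf mderiv_subst.
  rewrite (eq_bigr (fun l => subst S (mderiv l f) * (l == j)%:R
       - subst S (a 0 l *: mderiv l f) * mderiv j f)); last first.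
    move=> l _; rewrite !mxE raddfB /= mderivXU mderivM mderivC mulr0 addr0.
    by rewrite mulrBr linearZ /= -mul_mpolyC eq_sym; ring.
  rewrite sumrB -mulr_suml -raddf_sum /= -/(dird a f) f0 raddf0 mul0r subr0.
  rewrite (bigD1 j) //= eqxx mulr1 big1 ?addr0 // => l lj.
  by rewrite (negPf lj) mulr0.
have dg : dird a g = \sum_j dird a (P 0 j) * mderiv j f.
  rewrite /g raddf_sum; apply: eq_bigr => j _ /=.
  by rewrite dirdM dird_mderiv f0 raddf0 mulr0 addr0.
(* Chain rule with the Jacobian of [S], whose (j, l) entry is the Kronecker delta minus [a 0 l]
   times the j-th derivative of [f]. *)
have divE (A : 'rV[T]_n) : divg (map_mx (subst S) A) =
    subst S (divg A - \sum_j dird a (A 0 j) * mderiv j f).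
  have ss (h : 'I_n -> T) : subst S (\sum_i h i) = \sum_i subst S (h i).
    exact: raddf_sum.
  rewrite /divg raddfB /= !ss -sumrB; apply: eq_bigr => j _.
  rewrite mxE mderiv_subst rmorphM /= dSf [dird a _]/dird ss mulr_suml.
  rewrite (eq_bigr (fun l => subst S (mderiv l (A 0 j)) * (l == j)%:R
       - subst S (a 0 l *: mderiv l (A 0 j)) * mderiv j f)); last first.
    move=> l _; rewrite !mxE raddfB /= mderivXU mderivM mderivC mulr0 addr0.
    by rewrite mulrBr linearZ /= -mul_mpolyC eq_sym; ring.
  rewrite sumrB; congr (_ - _).
  rewrite (bigD1 j) //= eqxx mulr1 big1 ?addr0 // => l lj.
  by rewrite (negPf lj) mulr0.
rewrite divE; set B := P + _.
have -> : divg B = dird a g.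
  rewrite /divg /B (eq_bigr (fun i => mderiv i (P 0 i) + a 0 i *: mderiv i g)).
    by rewrite big_split /= -/(divg P) divP add0r.
  move=> i _; rewrite !mxE raddfD /= mderivM mderivC mulr0 addr0.
  by rewrite mulrC mul_mpolyC.
suff -> : \sum_j dird a (B 0 j) * mderiv j f = dird a g by rewrite subrr raddf0.
rewrite (eq_bigr (fun j => dird a (P 0 j) * mderiv j f
    + dird a g * (a 0 j *: mderiv j f))).
  by rewrite big_split /= -mulr_sumr -/(dird a f) f0 mulr0 addr0.
move=> j _; rewrite !mxE raddfD /= mulrDl dirdM; congr (_ + _).
have [c0 _] := invariant_alongC a (a 0 j).
by rewrite c0 mulr0 addr0 -mul_mpolyC mulrA.
Qed.

(* Modulo terms of order [k + 1], conjugating by a shear of order [k] adds to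
   the vector field its bracket with the shear direction. *)
Lemma shear_bracket k (N : 'rV[T]_n) P f a : (2 <= k)%N ->
  order_ge k f -> (forall i, exists M : 'rV[R]_n, N 0 i = \sum_j M 0 j *: id_n 0 j) ->
  (forall i, order_ge 2 (P 0 i - N 0 i)) ->
  forall j, order_ge k.+1
   ((map_mx (subst (id_n - f *: cst_row a))
      (P + (\sum_i P 0 i * mderiv i f) *: cst_row a)
     - P - bracket N (f *: cst_row a)) 0 j).
Proof.
move=> k2 fk Nlin PN j; set ca := cst_row a; set g := \sum_i _.
set S := id_n - _.
case: k k2 fk => [//|k] k2 fk.
have N1 i : order_ge 1 (N 0 i).
  have [M ->] := Nlin i; apply: order_ge_sum => l _; apply: order_geZ.
  by rewrite mxE; exact: order_geXU.
have P1 i : order_ge 1 (P 0 i).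
  by rewrite -(subrK (N 0 i) (P 0 i)); apply: order_geD => //; exact: order_geW (PN i).
have gk : order_ge k.+1 g.
  apply: order_ge_sum => i _; rewrite -add1n; apply: order_geM => //.
  exact: order_ge_mderivS.
have Sk i : order_ge k.+1 (S 0 i - id_n 0 i).
  rewrite /S !mxE addrAC subrr add0r; apply: order_geN; exact: order_geMl.
(* [N] is linear, so its expansion under [S] stops exactly at first order and yields the second half
   of the bracket. *)
have NS : subst S (N 0 j) = N 0 j - \sum_i f * ca 0 i * mderiv i (N 0 j).
  have [M ->] := Nlin j; rewrite linear_sum /= -sumrB.
  transitivity (\sum_i (M 0 i *: id_n 0 i - M 0 i *: (f * ca 0 i))); last first.
    rewrite !sumrB; congr (_ - _); apply: eq_bigr => i _.
    rewrite raddf_sum (bigD1 i) //= big1 ?addr0 => [|l li].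
      by rewrite linearZ /= mderiv_idmap eqxx -scalerAr mulr1.
    by rewrite linearZ /= mderiv_idmap eq_sym (negPf li) scaler0.
  apply: eq_bigr => i _; rewrite linearZ /= -scalerBr; congr (_ *: _).
  by rewrite {1}[id_n 0 i]mxE substXU /S !mxE.
set B := P 0 j - N 0 j.
(* The exact remainder has three terms: the nonlinear part [B] moved by [S], [g] moved by [S], and
   the derivative of [f] along the nonlinear part of [P]. The second has order 2k - 1 for the
   original k, so it needs [2 <= k]. *)
have -> : (map_mx (subst S) (P + g *: ca) - P - bracket N (f *: ca)) 0 j =
  (subst S B - B) + (subst S g - g) * ca 0 j
    + (\sum_i (P 0 i - N 0 i) * mderiv i f) * ca 0 j.
  rewrite !mxE rmorphD rmorphM /= comp_mpolyC.
  have -> : P 0 j = N 0 j + B by rewrite /B addrC subrK.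
  rewrite rmorphD /= NS.
  have -> : \sum_i (P 0 i - N 0 i) * mderiv i f = g - \sum_i N 0 i * mderiv i f.
    by rewrite -sumrB; apply: eq_bigr => i _; rewrite mulrBl.
  have -> : \sum_i N 0 i * jactr (f *: ca) i j
      = (\sum_i N 0 i * mderiv i f) * (mpolyC n (a 0 j)).
    rewrite mulr_suml; apply: eq_bigr => i _.
    by rewrite !mxE mderivM mderivC mulr0 addr0 mulrA.
  have -> : \sum_i (f *: ca) 0 i * jactr N i j
      = \sum_i f * ca 0 i * mderiv i (N 0 j).
    by apply: eq_bigr => i _; rewrite !mxE.
  rewrite /ca /cst_row ?mxE; ring.
apply: order_geD; first apply: order_geD.
- rewrite -(add2n k); apply: order_ge_substB => //; exact: PN.
- apply: order_geMl; apply: (@order_geW _ _ (k.+1 + k)); first by lia.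
  exact: order_ge_substB.
apply: order_geMl; apply: order_ge_sum => i _.
by rewrite -(add2n k); apply: order_geM => //; exact: order_ge_mderivS.
Qed.

End VolumePreservingAutomorphisms.

(** * Hamiltonian fields as sums of shear directions *)

Section ShearSums.
Variables (R : numFieldType) (n : nat).
Local Notation T := (mpoly n R).
Implicit Types (p q f g : T) (F G P Q Psi Phi : 'rV[T]_n) (a : 'rV[R]_n).

(** This avoids inverting a Vandermonde matrix. The value at [2 * t] minus [2 ^+ N] times the value
    at [t] has no term of degree [N], and each lower coefficient is only multiplied by the nonzero
    number [2 ^+ b - 2 ^+ N]; the top coefficient then follows from the value at 1. *)
Lemma interpolation (V : lmodType R) (S : V -> Prop) :
  S 0 -> (forall x y, S x -> S y -> S (x + y)) -> (forall c x, S x -> S (c *: x)) ->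
  forall N (v : nat -> V), (forall t : R, S (\sum_(b < N) t ^+ b *: v b)) ->
  forall b, (b < N)%N -> S (v b).
Proof.
move=> S0 SD SZ; elim=> [//|N IH] v Sv.
have SN x y : S x -> S y -> S (x - y).
  by move=> Sx Sy; rewrite -scaleN1r; apply: (SD) => //; exact: (SZ).
have low b : (b < N)%N -> S (v b).
  move=> bN; have c0 : (2 ^+ b - 2 ^+ N : R) != 0.
    rewrite subr_eq0; apply/eqP => /ieexprIn e.
    by rewrite e ?ltnn ?ltr0n ?pnatr_eq1 in bN.
  rewrite -[v b]scale1r -(mulVf c0) -scalerA; apply: (SZ).
  apply: (IH (fun b => (2 ^+ b - 2 ^+ N) *: v b)) bN => t.
  have := SN _ _ (Sv (2 * t)) (SZ (2 ^+ N) _ (Sv t)).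
  rewrite scaler_sumr -sumrB big_ord_recr /= exprMn scalerA subrr addr0.
  congr S; apply: eq_bigr => i _.
  by rewrite exprMn !scalerA -scalerBl; congr (_ *: _); ring.
move=> b; rewrite ltnS leq_eqVlt => /orP[/eqP->|]; last exact: low.
have := Sv 1; rewrite big_ord_recr /= expr1n scale1r => St.
have -> : v N = \sum_(i < N) 1 ^+ i *: v i + v N - \sum_(i < N) v i.
  by rewrite (eq_bigr (fun i : 'I_N => v i)) 1?addrC ?addKr // => i _;
    rewrite expr1n scale1r.
by apply: (SN) => //; elim/big_ind: _ => // i _; exact: low.
Qed.

(** Built one summand at a time because [shear_sum_conjugacy] recurses on it and composes one more
    automorphism per summand. *)
Inductive shear_sum k : 'rV[T]_n -> Prop :=
| ShearSum0 : shear_sum k 0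
| ShearSumD F f a : shear_sum k F -> order_ge k f -> invariant_along a f ->
    shear_sum k (F + f *: cst_row a).

Lemma shear_sum1 k f a :
  order_ge k f -> invariant_along a f -> shear_sum k (f *: cst_row a).
Proof. by move=> fk fa; rewrite -[_ *: _]add0r; apply: ShearSumD => //; exact: ShearSum0. Qed.

Lemma shear_sumD k F G : shear_sum k F -> shear_sum k G -> shear_sum k (F + G).
Proof.
move=> Fk; elim=> [|G' f a _ IH fk fa]; first by rewrite addr0.
by rewrite addrA; exact: ShearSumD.
Qed.

Lemma shear_sumZ k c F : shear_sum k F -> shear_sum k (mpolyC n c *: F).
Proof.
elim=> [|G f a _ IH fk fa]; first by rewrite scaler0; exact: ShearSum0.
rewrite scalerDr scalerA mul_mpolyC; apply: ShearSumD => //.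
  exact: order_geZ.
exact: invariant_alongZ.
Qed.

Lemma shear_sum_order k F : shear_sum k F -> forall i, order_ge k (F 0 i).
Proof.
elim=> [|G f a _ IH fk fa] i; first by rewrite mxE; exact: order_ge0.
by rewrite mxE; apply: order_geD => //; rewrite mxE; exact: order_geMl.
Qed.

(** The Hamiltonian field of [p] in the plane of x_i and x_j, the other coordinates being
    parameters. *)
Definition hamiltonian i j p : 'rV[T]_n :=
  mderiv j p *: delta_mx 0 i - mderiv i p *: delta_mx 0 j.

Lemma hamiltonianD i j p q :
  hamiltonian i j (p + q) = hamiltonian i j p + hamiltonian i j q.
Proof. by rewrite /hamiltonian !raddfD /= !scalerDl opprD addrACA. Qed.

Lemma hamiltonianZ i j c p : hamiltonian i j (c *: p) = mpolyC n c *: hamiltonian i j p.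
Proof. by rewrite /hamiltonian !mderivZ scalerBr !scalerA !mul_mpolyC. Qed.

Lemma dird_delta i p : dird (delta_mx 0 i) p = mderiv i p.
Proof.
rewrite /dird (bigD1 i) //= mxE !eqxx scale1r big1 ?addr0 // => j ji.
by rewrite mxE (negPf ji) andbF scale0r.
Qed.

Lemma invariant_along_prod a (S : pred 'I_n) (m : multinom n) :
  (forall i, S i -> a 0 i = 0) ->
  invariant_along a (\prod_(i | S i) mpolyX R (mnm1 i) ^+ m i).
Proof.
move=> aS; elim/big_ind: _ => [||i Si].
- by rewrite -mpolyC1; exact: invariant_alongC.
- by move=> p q; exact: invariant_alongM.
by apply: invariant_alongXn; apply: invariant_alongXU; exact: aS.
Qed.

(* The Hamiltonian field of [W * (x_i + t x_j)^d], with [W] free of [x_i] and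
   [x_j], points in the constant direction [t e_i - e_j] and is a shear. *)
Lemma hamiltonian_shear i j k d e W t : i != j ->
  (forall a, (forall l, l != i -> l != j -> a 0 l = 0) -> invariant_along a W) ->
  order_ge e W -> (k < e + d)%N ->
  shear_sum k (hamiltonian i j
    (W * (mpolyX R (mnm1 i) + t *: mpolyX R (mnm1 j)) ^+ d)).
Proof.
move=> ij Winv We ked; set L := _ + _.
have dW l : l \in [:: i; j] -> mderiv l W = 0.
  rewrite !inE => lij; rewrite -dird_delta.
  have [] // := Winv (delta_mx 0 l); move=> l' l'i l'j; rewrite mxE eqxx /=.
  by case: (l' =P l) lij => // <-; rewrite (negPf l'i) (negPf l'j).
have dL l : mderiv l L = (l == i)%:R + t *: (l == j)%:R.
  by rewrite mderivD mderivZ !mderivXU.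
(* For [d = 0] the truncated exponent [d.-1] is harmless, since [*+ d] annihilates the term. *)
have dXn l : mderiv l (L ^+ d) = (L ^+ d.-1 * mderiv l L) *+ d.
  case: d {ked} => [|d]; first by rewrite expr0 mulr0n -mpolyC1 mderivC.
  elim: d => [|d IH]; first by rewrite expr1 expr0 mul1r.
  by rewrite exprS mderivM IH /= -mulrnAr mulrCA -mulrnAr -[_ *+ d.+2]mulr_natr
    exprS -[_ *+ d.+1]mulr_natr; ring.
set a : 'rV[R]_n := t *: delta_mx 0 i - delta_mx 0 j.
have aE l : a 0 l = t * (l == i)%:R - (l == j)%:R.
  by rewrite !mxE eqxx.
have -> : hamiltonian i j (W * L ^+ d) = (W * L ^+ d.-1 *+ d) *: cst_row a.
  apply/rowP => l; rewrite !mxE !mderivM !dW ?inE ?eqxx ?orbT // !mul0r !add0r.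
  rewrite !dXn !dL !eqxx [j == i]eq_sym (negPf ij) -!mulrnAr /=.
  rewrite mpolyCB mpolyCM !rmorph_nat -[t *: 1]mul_mpolyC scaler0.
  have [c mulc] : exists c : T, forall z, z *+ d = z * c.
    by exists d%:R => z; rewrite mulr_natr.
  by rewrite !mulc; ring.
have aL : a 0 i = t /\ a 0 j = -1.
  by rewrite !aE !eqxx [j == i]eq_sym (negPf ij) mulr1 mulr0 subr0 sub0r.
apply: shear_sum1.
  case: d ked {dXn} => [|d] ked; first by rewrite mulr0n; exact: order_ge0.
  rewrite -scaler_nat; apply: order_geZ.
  apply: (@order_geW _ _ (e + 1 * d)); first by lia.
  apply: order_geM => //; apply: order_geXn; apply: order_geD.
    exact: order_geXU.
  by apply: order_geZ; exact: order_geXU.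
rewrite -scaler_nat; apply: invariant_alongZ; apply: invariant_alongM.
  by apply: (Winv) => l li lj; rewrite aE (negPf li) (negPf lj) mulr0 subr0.
apply: invariant_alongXn; split=> [|g].
  rewrite /dird (eq_bigr (fun l => a 0 l *: (l == i)%:R + (t * a 0 l) *: (l == j)%:R)).
    rewrite big_split /= (bigD1 i) //= [X in _ + X](bigD1 j) //=.
    rewrite !big1 => [|l lj|l li]; rewrite ?(negPf lj) ?(negPf li) ?scaler0 //.
    by rewrite !eqxx !addr0 aL.1 aL.2 mulrN1 scaleNr subrr.
  by move=> l _; rewrite dL scalerDr scalerA [a 0 l * t]mulrC.
have aE' l : (idmap R n + g *: cst_row a) 0 l = mpolyX R (mnm1 l) + g * mpolyC n (a 0 l).
  by rewrite mxE [idmap _ _ _ _]mxE mxE [cst_row _ _ _]mxE.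
rewrite comp_mpolyD comp_mpolyZ !substXU !aE' aL.1 aL.2 mpolyCN mpolyC1 /L.
by rewrite -!mul_mpolyC; ring.
Qed.

Lemma shear_sum_hamiltonian i j k p : i != j ->
  order_ge k.+1 p -> shear_sum k (hamiltonian i j p).
Proof.
move=> ij; move: p; apply: order_ge_ind.
- by rewrite /hamiltonian !raddf0 !scale0r subr0; exact: ShearSum0.
- by move=> p q hp hq; rewrite hamiltonianD; exact: shear_sumD.
move=> c m mk; rewrite hamiltonianZ; apply: shear_sumZ.
set W := \prod_(l | (l != i) && (l != j)) mpolyX R (mnm1 l) ^+ m l.
pose d := (m i + m j)%N; pose x := mpolyX R (mnm1 i); pose y := mpolyX R (mnm1 j).
have mW : mpolyX R m = W * (x ^+ m i * y ^+ m j).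
  rewrite mpolyXE_id (bigD1 i) //= (bigD1 j) 1?eq_sym //= /W -/x -/y.
  by rewrite mulrA mulrC; congr (_ * _).
set e := (\sum_(l | (l != i) && (l != j)) m l)%N.
have We : order_ge e W.
  rewrite /W mprodXnE; have -> : e = mdeg
     (\big[@mnm_add n/@mnm0 n]_(l | (l != i) && (l != j)) (mnm_muln (mnm1 l) (m l))).
    by rewrite mdeg_sum; apply: eq_bigr => l _; rewrite mdegMn mdeg1 mul1n.
  exact: order_geX.
have ed : (k < e + d)%N.
  apply: leq_trans mk _; rewrite mdegE (bigD1 i) //= (bigD1 j) 1?eq_sym //= /d /e.
  by rewrite addnA addnC.
(* The monomial is, up to a binomial coefficient, the coefficient of [t ^+ m j] in
   [W * (x + t y) ^+ d]. The shear lemma covers all values of t, interpolation isolates the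
   coefficient, and the binomial is invertible in characteristic 0. *)
have := @interpolation T (fun q => shear_sum k (hamiltonian i j q)) _ _ _ d.+1
  (fun b => 'C(d, b)%:R *: (W * (x ^+ (d - b) * y ^+ b))).
have h0 : shear_sum k (hamiltonian i j 0).
  by rewrite /hamiltonian !raddf0 !scale0r subr0; exact: ShearSum0.
have hD p q : shear_sum k (hamiltonian i j p) -> shear_sum k (hamiltonian i j q) ->
   shear_sum k (hamiltonian i j (p + q)).
  by move=> hp hq; rewrite hamiltonianD; exact: shear_sumD.
have hZ c' q : shear_sum k (hamiltonian i j q) -> shear_sum k (hamiltonian i j (c' *: q)).
  by move=> hq; rewrite hamiltonianZ; exact: shear_sumZ.
move=> /(_ h0 hD hZ) interp.
have : shear_sum k (hamiltonian i j ('C(d, m j)%:R *: (W * (x ^+ (d - m j) * y ^+ m j)))).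
  apply: interp; last by rewrite ltnS /d leq_addl.
  move=> t; have := @hamiltonian_shear i j k d e W t ij _ We ed.
  rewrite -/x -/y exprDn mulr_sumr; set s1 := \sum_(b < _) _; set s2 := \sum_(b < _) _.
  suff -> : s1 = s2.
    apply=> a al; apply: invariant_along_prod => l /andP[li lj]; exact: al.
  apply: eq_bigr => b _; rewrite exprZn mulrnAr -[LHS]scaler_nat -!scalerAr.
  by rewrite !scalerA mulrC.
move=> /(hZ 'C(d, m j)%:R^-1); rewrite scalerA mulVf ?scale1r ?pnatr_eq0.
  by rewrite mW /d addnK.
by rewrite -lt0n bin_gt0 leq_addl.
Qed.
End ShearSums.

(** * Homogeneous polynomials, the spaces on which [nilder] is nilpotent *)

Section HomogeneousPolynomials.
Variables (R : numFieldType) (n : nat).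
Implicit Types (p q : mpoly n R) (m : multinom n) (i j : 'I_n) (k d : nat).

Definition homog d p := forall m, mdeg m != d -> mcoeff m p = 0.

Lemma homogD d p q : homog d p -> homog d q -> homog d (p + q).
Proof. by move=> pd qd m md; rewrite mcoeffD pd ?qd ?addr0. Qed.

Lemma homogZ d c p : homog d p -> homog d (c *: p).
Proof. by move=> pd m md; rewrite mcoeffZ pd ?mulr0. Qed.

Lemma homogX m : homog (mdeg m) (mpolyX R m).
Proof. by move=> m' mm'; rewrite mcoeffX; case: (m =P m') mm' => // ->; rewrite eqxx. Qed.

Lemma homogM d e p q : homog d p -> homog e q -> homog (d + e) (p * q).
Proof.
move=> pd qe m mde; rewrite mcoeffM big1 // => -[m1 m2] /= /eqP em.
have mE : mdeg m = (mdeg m1 + mdeg m2)%N by rewrite -mdegD -em.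
have [m1d|m1d] := eqVneq (mdeg m1) d; last by rewrite pd ?mul0r.
by rewrite qe ?mulr0 //; apply: contra mde => /eqP m2e; rewrite mE m1d m2e.
Qed.

Lemma homog_ind d (S : mpoly n R -> Prop) :
  S 0 -> (forall p q, S p -> S q -> S (p + q)) ->
  (forall c m, mdeg m = d -> S (c *: mpolyX R m)) ->
  forall p, homog d p -> S p.
Proof.
move=> S0 SD SX p pd; rewrite [p]mpolyE big_seq.
elim/big_ind: _ => // m mp; apply: SX; apply/eqP/negPn/negP => /pd pm0.
by move: mp; rewrite mcoeff_msupp pm0 eqxx.
Qed.

Lemma homog_mderiv d i p : homog d.+1 p -> homog d (mderiv i p).
Proof.
move=> pd m md; rewrite mcoeff_mderiv pd ?mul0rn //.
by rewrite mdegD mdeg1 addn1 eqSS.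
Qed.

Lemma homog_mderiv0 i p : homog 0 p -> mderiv i p = 0.
Proof.
move=> p0; apply/mpolyP => m; rewrite mcoeff_mderiv mcoeff0 p0 ?mul0rn //.
by rewrite mdegD mdeg1 addn1.
Qed.

Lemma homog_order d p : homog d p -> order_ge d p.
Proof. by move=> pd m md; apply: pd; rewrite neq_ltn md. Qed.

Lemma homog_antiderivative d i p : homog d p ->
  exists2 q, homog d.+1 q & mderiv i q = p.
Proof.
move: p; apply: homog_ind.
- by exists 0; [move=> m _; rewrite mcoeff0 | rewrite raddf0].
- move=> _ _ [p pk <-] [q qk <-]; exists (p + q); first exact: homogD.
  by rewrite raddfD.
- move=> c m md; exists ((c / (m i).+1%:R) *: mpolyX R (mnm_add m (mnm1 i))).
    apply: homogZ; have <- : mdeg (mnm_add m (mnm1 i)) = d.+1.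
      by rewrite mdegD mdeg1 addn1 md.
    exact: homogX.
  rewrite linearZ /= mderivX mnmDE mnm1E eqxx addn1 addmK scalerA.
  by rewrite divfK // pnatr_eq0.
Qed.

Lemma mderiv_eq0 i p m : mderiv i p = 0 -> mcoeff m p != 0 -> m i = 0%N.
Proof.
move=> p0; apply: contraNeq; rewrite -lt0n => mi.
have := congr1 (mcoeff (mnm_sub m (mnm1 i))) p0.
rewrite mcoeff_mderiv mcoeff0 submK; last by rewrite lep1mP -lt0n.
by move/eqP; rewrite mulrn_eq0.
Qed.

End HomogeneousPolynomials.

(** * Coordinates and row vectors in dimension three *)

Definition i0 : 'I_3 := @Ordinal 3 0 isT.
Definition i1 : 'I_3 := @Ordinal 3 1 isT.
Definition i2 : 'I_3 := @Ordinal 3 2 isT.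

Lemma ord3P (S : 'I_3 -> Prop) : S i0 -> S i1 -> S i2 -> forall i, S i.
Proof.
move=> S0 S1 S2 [[|[|[|m]]] lt_m] //.
- by rewrite (_ : Ordinal lt_m = i0) //; exact: val_inj.
- by rewrite (_ : Ordinal lt_m = i1) //; exact: val_inj.
- by rewrite (_ : Ordinal lt_m = i2) //; exact: val_inj.
Qed.

Lemma sum_ord3 (V : nmodType) (F : 'I_3 -> V) : \sum_i F i = F i0 + F i1 + F i2.
Proof.
rewrite !big_ord_recl big_ord0 addr0 addrA.
by congr (F _ + F _ + F _); exact: val_inj.
Qed.

Definition row3 (A : nzRingType) (p q r : A) : 'rV[A]_3 := \row_i nth 0 [:: p; q; r] i.

(** The left-hand side is the shape of two Hamiltonian fields, in the planes (x, y) and (y, z), plus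
    a field along the third axis, as it arises in [divfree_shear_sum]. *)
Lemma row3_delta (A : nzRingType) (p q r s t : A) :
  p *: delta_mx 0 i0 - q *: delta_mx 0 i1 + (r *: delta_mx 0 i1 - s *: delta_mx 0 i2)
    + t *: delta_mx 0 i2 = row3 p (r - q) (t - s).
Proof.
apply/rowP; apply: ord3P; rewrite !mxE /= ?mulr1 ?mulr0.
- by rewrite !subr0 !addr0.
- by rewrite subr0 addr0 sub0r addrC.
- by rewrite subr0 add0r sub0r addrC.
Qed.

Lemma row_subE (V : zmodType) n (F G : 'rV[V]_n) i : (F - G) 0 i = F 0 i - G 0 i.
Proof. by rewrite !mxE. Qed.

(** Bookkeeping of one normalization step: [s] and [s'] are the old and new fields, [l] the linear
    part, [r] the normal form so far, [x] the bracket and [r'] the new normal-form term. *)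
Lemma subr_residual (V : zmodType) (s s' l r r' x : V) :
  s - l - r + x = r' -> s' - l - (r + r') = s' - s - x.
Proof.
move=> <-; have -> : r + (s - l - r + x) = s - l + x.
  by rewrite addrA [r + _]addrC subrK.
by rewrite opprD opprB addrA [s' - l + _]addrA subrK.
Qed.

Lemma row3_0 (A : nzRingType) : row3 0 0 0 = 0 :> 'rV[A]_3.
Proof. by apply/rowP; apply: ord3P; rewrite !mxE. Qed.

Lemma row3D (A : nzRingType) (p q r p' q' r' : A) :
  row3 p q r + row3 p' q' r' = row3 (p + p') (q + q') (r + r').
Proof. by apply/rowP; apply: ord3P; rewrite !mxE. Qed.

Lemma divgB (R : numFieldType) n (F G : 'rV[mpoly n R]_n) : divg (F - G) = divg F - divg G.
Proof. by rewrite /divg -sumrB; apply: eq_bigr => i _; rewrite !mxE mderivB. Qed.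

Lemma divg_row3 (R : numFieldType) (p q r : mpoly 3 R) :
  divg (row3 p q r) = mderiv i0 p + mderiv i1 q + mderiv i2 r.
Proof. by rewrite /divg sum_ord3 !mxE. Qed.

(* Locked, since unification would otherwise unfold [nilder p] into a sum when
   distributing derivatives over sums. *)
HB.lock Definition nilder (R : numFieldType) (p : mpoly 3 R) : mpoly 3 R :=
  mpolyX R (mnm1 i1) * mderiv i0 p + mpolyX R (mnm1 i2) * mderiv i1 p.

Lemma order_ge_split (R : numFieldType) n k (P Q S F G : 'rV[mpoly n R]_n) :
  (forall i, order_ge k ((Q - P - F) 0 i)) ->
  (forall i, order_ge k ((S - Q - G) 0 i)) ->
  forall i, order_ge k ((S - P - (F + G)) 0 i).
Proof.
move=> QP SQ i; have -> : S - P - (F + G) = (Q - P - F) + (S - Q - G).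
  by rewrite addrACA [Q - P + _]addrC [S - Q + _]addrA subrK opprD.
by rewrite mxE; exact: order_geD.
Qed.

(** * The homological equation and the polynomial normal form *)

Section HomologicalEquation.
Variable R : numFieldType.
Local Notation T := (mpoly 3 R).
Local Notation X i := (mpolyX R (mnm1 i)).
Local Notation "'d0' p" := (mderiv i0 p) (at level 10, p at next level).
Local Notation "'d1' p" := (mderiv i1 p) (at level 10, p at next level).
Local Notation "'d2' p" := (mderiv i2 p) (at level 10, p at next level).
Implicit Types (p q g h : T).

Lemma nilderE p : nilder p = X i1 * d0 p + X i2 * d1 p.
Proof. by rewrite nilder.unlock. Qed.

Lemma nilder_is_linear : linear (@nilder R).
Proof.
move=> c p q; rewrite !nilderE !linearP /= !mulrDr scalerDr !scalerAr addrACA.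
by [].
Qed.
HB.instance Definition _ :=
  GRing.isLinear.Build R T T _ (@nilder R) nilder_is_linear.

Lemma nilderD p q : nilder (p + q) = nilder p + nilder q.
Proof. exact: raddfD. Qed.

Lemma nilderM p q : nilder (p * q) = nilder p * q + p * nilder q.
Proof. by rewrite !nilderE !mderivM; ring. Qed.

Lemma mderiv0_nilder p : d0 (nilder p) = nilder (d0 p).
Proof.
rewrite !nilderE mderivD !mderivM !mderivXU !mul0r !add0r.
by rewrite (mderiv_comm i0 i1).
Qed.

Lemma mderiv1_nilder p : d1 (nilder p) = nilder (d1 p) + d0 p.
Proof.
rewrite !nilderE mderivD !mderivM !mderivXU mul0r add0r mul1r.
by rewrite (mderiv_comm i1 i0); ring.
Qed.

Lemma mderiv2_nilder p : d2 (nilder p) = nilder (d2 p) + d1 p.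
Proof.
rewrite !nilderE mderivD !mderivM !mderivXU mul0r add0r mul1r.
by rewrite !(mderiv_comm i2); ring.
Qed.

Local Notation Dn m := (iter m (@nilder R)).

Lemma iter_nilderD m p q : Dn m (p + q) = Dn m p + Dn m q.
Proof. by elim: m => //= m ->; rewrite raddfD. Qed.

Lemma iter_nilderZ m c p : Dn m (c *: p) = c *: Dn m p.
Proof. by elim: m => //= m ->; rewrite linearZ. Qed.

Lemma iter_nilder0 m : Dn m 0 = 0.
Proof. by elim: m => //= m ->; rewrite raddf0. Qed.

Lemma homog_nilder d p : homog d p -> homog d (nilder p).
Proof.
case: d => [|d] pd.
  by rewrite nilderE !homog_mderiv0 // !mulr0 addr0 => m _; rewrite mcoeff0.
have X1 i : homog 1 (X i) by rewrite -(mdeg1 i); exact: homogX.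
by rewrite nilderE; apply: homogD; rewrite -[d.+1]add1n; apply: homogM => //; exact: homog_mderiv.
Qed.

Lemma homog_iter_nilder d m p : homog d p -> homog d (Dn m p).
Proof. by move=> pd; elim: m => //= m IH; exact: homog_nilder. Qed.

Lemma mderiv0_iter m p : d0 (Dn m p) = Dn m (d0 p).
Proof. by elim: m => //= m IH; rewrite mderiv0_nilder IH. Qed.

Lemma mderiv1_iter m p :
  d1 (Dn m p) = Dn m (d1 p) + Dn m.-1 (d0 p) *+ m.
Proof.
elim: m => [|m IH]; first by rewrite addr0.
rewrite /= mderiv1_nilder IH raddfD raddfMn /= mderiv0_iter -addrA; congr (_ + _).
by case: m {IH} => [|m] /=; rewrite [in RHS]mulrSr // !mulr0n !add0r.
Qed.

(** Moving d_z past a factor L may turn it into d_y, and past a later one into d_x; the binomial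
    counts the pairs of factors. The truncated [m.-1] and [m.-2] go wrong only where the
    multiplicity is 0. *)
Lemma mderiv2_iter m p :
  d2 (Dn m p) = Dn m (d2 p) + Dn m.-1 (d1 p) *+ m
    + Dn m.-2 (d0 p) *+ 'C(m, 2).
Proof.
elim: m => [|m IH]; first by rewrite !addr0.
rewrite binS bin1 iterS mderiv2_nilder IH !raddfD !raddfMn mderiv1_iter.
have := @bin_small m 2; move: 'C(m, 2) => c c0.
case: m {IH} c0 => [|[|m]] c0; rewrite /=.
- by rewrite c0 // !mulr0n mulr1n; ring.
- by rewrite c0 // ?add0n ?mulr0n ?mulr1n mulr2n; ring.
by rewrite [_ *+ m.+3]mulrSr; ring.
Qed.

(** By the product rule one application of L falls on [p] or on [q] and lowers [a] or [b], so
    induction on [a + b] replaces the binomial form of the Leibniz rule. *)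
Lemma nilpotentM a b p q : Dn a.+1 p = 0 -> Dn b.+1 q = 0 ->
  Dn (a + b).+1 (p * q) = 0.
Proof.
have [N] := ubnP (a + b); elim: N a b p q => // N IH a b p q abN pa qb.
rewrite iterSr nilderM iter_nilderD.
have -> : Dn (a + b) (nilder p * q) = 0.
  case: a pa abN => [/= ->|a pa abN]; first by rewrite mul0r iter_nilder0.
  rewrite addSn; apply: (IH) => //; last by rewrite -iterSr.
case: b qb abN => [/= ->|b qb abN]; first by rewrite mulr0 iter_nilder0 addr0.
by rewrite addnS add0r; apply: (IH) => //; [lia | rewrite -iterSr].
Qed.

(** L sends x to y, y to z and z to 0, so [Dn 3] kills each variable: every degree contributes at
    most 2, and these contributions add under products. *)
Lemma nilder_nilpotent d p : homog d p -> Dn (2 * d).+1 p = 0.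
Proof.
move: p; apply: homog_ind => [|p q hp hq|c m <-]; first exact: iter_nilder0.
  by rewrite iter_nilderD hp hq addr0.
rewrite iter_nilderZ [m]multinomUE_id.
have -> : Dn (2 * mdeg (\big[@mnm_add 3/@mnm0 3]_i (mnm_muln (mnm1 i) (m i)))).+1
  (mpolyX R (\big[@mnm_add 3/@mnm0 3]_i (mnm_muln (mnm1 i) (m i)))) = 0; last by rewrite scaler0.
elim/big_ind: _ => [|m1 m2 h1 h2|i _].
- rewrite mdeg0 mpolyX0 /= nilderE -mpolyC1 !mderivC; ring.
- by rewrite mdegD mpolyXD mulnDr; exact: nilpotentM.
rewrite mdegMn mdeg1 mul1n; elim: (m i) => [|e IH].
  by rewrite mulm0n mpolyX0 /= nilderE -mpolyC1 !mderivC; ring.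
rewrite mulmS mpolyXD mulnS; apply: nilpotentM => //.
have nX2 : nilder (X i2) = 0 by rewrite nilderE !mderivXU !mulr0 addr0.
have nX1 : nilder (X i1) = X i2 by rewrite nilderE !mderivXU mulr0 add0r mulr1.
have nX0 : nilder (X i0) = X i1 by rewrite nilderE !mderivXU mulr0 addr0 mulr1.
by move: i {IH}; apply: ord3P; rewrite /= ?nX0 ?nX1 nX2 ?raddf0.
Qed.

(* The divergence of the field [(h, L h, L^2 h)], where [L] is [nilder]. *)
Definition divchain h : T := d0 h + d1 (nilder h) + d2 (nilder (nilder h)).

Lemma divchainD p q : divchain (p + q) = divchain p + divchain q.
Proof.
by rewrite /divchain !nilderD !mderivD; ring.
Qed.

Lemma divchain0 : divchain 0 = 0.
Proof. by apply: (addrI (divchain 0)); rewrite -divchainD !addr0. Qed.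

(** The three summands of [divchain] contribute 1, m + 1 and 'C(m + 2, 2) to the coefficient of L^m
    d_x, and 0, 1 and m + 2 to that of L^(m+1) d_y. *)
Lemma divchain_iter m h : divchain (Dn m h) =
  (m + 2 + 'C(m.+2, 2))%:R *: Dn m (d0 h)
  + Dn m.+1 (m.+3%:R *: d1 h + nilder (d2 h)).
Proof.
rewrite /divchain -!iterS mderiv0_iter mderiv1_iter mderiv2_iter.
rewrite iter_nilderD iter_nilderZ -[Dn m.+1 (nilder _)]iterSr.
move: 'C(m.+2, 2) => c; rewrite /= !scaler_nat !mulrnDr.
by rewrite !(mulrSr _ m.+2) !(mulrSr _ m.+1) !(mulrSr _ m); ring.
Qed.

(* Downward induction on [s]: [divchain] is invertible modulo higher powers of
   [nilder], and high powers of [nilder] vanish. *)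
Lemma divchain_surj_iter d s q : homog d q ->
  exists2 h, homog d.+1 h & divchain h = Dn s q.
Proof.
have [N] := ubnP ((2 * d).+1 - s); elim: N s q => // N IH s q sN qd.
have [sd|sd] := ltnP (2 * d) s.
  exists 0; first by move=> m _; rewrite mcoeff0.
  have -> : Dn s q = 0.
    rewrite -(subnK sd) iterD nilder_nilpotent //; exact: iter_nilder0.
  by rewrite divchain0.
have [h hd hq] := @homog_antiderivative R 3 d i0 _ qd.
pose c : R := (s + 2 + 'C(s.+2, 2))%:R.
have c0 : c != 0 by rewrite pnatr_eq0 !addn_eq0 andbF.
(* The first guess [Dn s (c^-1 *: h)] yields [Dn s q - Dn s.+1 q']; the induction hypothesis at
   [s.+1] supplies the correction. *)
pose q' := - (s.+3%:R *: d1 (c^-1 *: h) + nilder (d2 (c^-1 *: h))).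
have q'd : homog d q'.
  rewrite /q' -scaleN1r; apply: homogZ; apply: homogD.
    by apply: homogZ; apply: homog_mderiv; exact: homogZ.
  by apply: homog_nilder; apply: homog_mderiv; exact: homogZ.
have [|h' h'd h'q] := IH s.+1 q' _ q'd; first by lia.
exists (Dn s (c^-1 *: h) + h').
  by apply: homogD => //; apply: homog_iter_nilder; exact: homogZ.
rewrite divchainD h'q divchain_iter -/c mderivZ hq iter_nilderZ scalerA divff //.
by rewrite scale1r -addrA -iter_nilderD subrr iter_nilder0 addr0.
Qed.

Lemma divchain_surj k g : order_ge k g ->
  exists2 h, order_ge k.+1 h & divchain h = g.
Proof.
move: g; apply: order_ge_ind.
- by exists 0; [exact: order_ge0 | exact: divchain0].
- move=> _ _ [p pk <-] [q qk <-]; exists (p + q); first exact: order_geD.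
  by rewrite divchainD.
move=> c m km; have [|h hd hE] := @divchain_surj_iter (mdeg m) 0 (c *: mpolyX R m).
  by apply: homogZ; exact: homogX.
exists h => //; apply: order_geW (homog_order hd); exact: km.
Qed.

Lemma order_ge_nilder k p : order_ge k p -> order_ge k (nilder p).
Proof.
case: k => [|k] pk; first exact: order_ge_any.
by rewrite nilderE; apply: order_geD; rewrite -(add1n k);
  apply: order_geM (@order_geXU _ _ _) (order_ge_mderivS _ pk).
Qed.

Definition shift_field : 'rV[T]_3 := row3 (X i1) (X i2) 0.

Lemma shift_fieldE : forall i, exists M : 'rV[R]_3,
  shift_field 0 i = \sum_j M 0 j *: idmap R 3 0 j.
Proof.
apply: ord3P; [exists (delta_mx 0 i1)|exists (delta_mx 0 i2)|exists 0];
  by rewrite sum_ord3 !mxE ?scale1r ?scale0r ?add0r ?addr0.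
Qed.

Lemma bracket_shift_field (h : 'rV[T]_3) : bracket shift_field h =
  row3 (nilder (h 0 i0) - h 0 i1) (nilder (h 0 i1) - h 0 i2) (nilder (h 0 i2)).
Proof.
apply/rowP; apply: ord3P; rewrite !mxE !sum_ord3 !mxE /= ?nilderE
  ?mderivXU ?raddf0 /=; ring.
Qed.

(** That [p] is independent of z has a conceptual reason: brackets of divergence-free fields are
    divergence-free, so the left-hand side of the last equation has divergence 0, while the
    right-hand side has divergence [d2 p]. The proof checks this by direct computation. *)
Lemma homological_equation k (b : 'rV[T]_3) :
  (forall i, order_ge k (b 0 i)) -> divg b = 0 ->
  exists h : 'rV[T]_3, exists p, [/\ (forall i, order_ge k (h 0 i)), divg h = 0,
    order_ge k p, d2 p = 0 & b + bracket shift_field h = row3 0 0 p].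
Proof.
move=> bk divb.
(* Chosen so that the divergence of (h0, h1, h2) is [divchain h0 - g]: it gathers the terms free of
   [h0]. *)
pose g := - (d1 (b 0 i0) + d2 (b 0 i1 + nilder (b 0 i0))).
have gk : order_ge k.-1 g.
  apply: order_geN; apply: order_geD; apply: order_ge_mderiv => //.
  by apply: order_geD => //; exact: order_ge_nilder.
have [h0 h0k h0g] := divchain_surj gk.
have {}h0k : order_ge k h0 by apply: order_geW h0k; lia.
pose h1 := b 0 i0 + nilder h0; pose h2 := b 0 i1 + nilder h1.
have h1k : order_ge k h1 by apply: order_geD => //; exact: order_ge_nilder.
have h2k : order_ge k h2 by apply: order_geD => //; exact: order_ge_nilder.
exists (row3 h0 h1 h2); exists (b 0 i2 + nilder h2).
have divh : d0 h0 + d1 h1 + d2 h2 = 0.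
  move/eqP: h0g; rewrite -subr_eq0 => /eqP e; rewrite -[RHS]e.
  by rewrite /divchain /g /h2 /h1 !nilderD !mderivD; ring.
split.
- by apply: ord3P; rewrite mxE.
- by rewrite /divg sum_ord3 !mxE.
- by apply: order_geD => //; exact: order_ge_nilder.
- have d2h2 : d2 h2 = - d0 h0 - d1 h1.
    by apply/eqP; rewrite eq_sym -subr_eq0 -oppr_eq0 -divh; apply/eqP; ring.
  have d1h2 : d1 h2 = d1 (b 0 i1) + nilder (d1 h1) + d0 h1.
    by rewrite mderivD mderiv1_nilder addrA.
  have d0h1 : d0 h1 = d0 (b 0 i0) + nilder (d0 h0).
    by rewrite mderivD mderiv0_nilder.
  rewrite mderivD mderiv2_nilder d2h2 d1h2 d0h1 raddfB raddfN /=.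
  by move: divb; rewrite /divg sum_ord3 => <-; ring.
rewrite bracket_shift_field; apply/rowP; apply: ord3P;
  rewrite !mxE /= /h2 /h1; ring.
Qed.

(** In characteristic 0 a vanishing derivative means that the variable occurs in no monomial, so
    moving it changes nothing. *)
Lemma invariant_along_delta (i : 'I_3) p : mderiv i p = 0 -> invariant_along (delta_mx 0 i) p.
Proof.
move=> p0; rewrite [p]mpolyE big_seq; elim/big_ind: _ => [|q r|m mp].
- by rewrite -mpolyC0; exact: invariant_alongC.
- exact: invariant_alongD.
apply: invariant_alongZ; rewrite mpolyXE_id (bigD1 i) //=.
rewrite (mderiv_eq0 p0) -?mcoeff_msupp // expr0 mul1r.
by apply: invariant_along_prod => j ji; rewrite mxE (negPf ji) andbF.
Qed.

Lemma cst_row_delta (i : 'I_3) : cst_row (delta_mx 0 i) = delta_mx 0 i :> 'rV[T]_3.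
Proof. by apply/rowP => j; rewrite !mxE; case: (_ && _); rewrite ?mpolyC0 ?mpolyC1. Qed.

(** Choose F with d_y F = h_1, then G with d_z G = h_2 + d_x F. Their Hamiltonian fields account for
    the first two components, and what remains of the third is independent of z because div h = 0:
    it is a shear along the third axis. *)
Lemma divfree_shear_sum k (h : 'rV[T]_3) :
  (forall i, order_ge k (h 0 i)) -> divg h = 0 -> shear_sum k h.
Proof.
move=> hk; rewrite /divg sum_ord3 => divh.
have [F Fk FE] := exists_antiderivative i1 (hk i0).
have hFk : order_ge k (h 0 i1 + d0 F).
  by apply: order_geD => //; exact: order_ge_mderivS.
have [G Gk GE] := exists_antiderivative i2 hFk.
have -> : h = hamiltonian i0 i1 F + hamiltonian i1 i2 G
    + (h 0 i2 + d1 G) *: cst_row (delta_mx 0 i2).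
  rewrite cst_row_delta row3_delta FE GE; apply/rowP; apply: ord3P.
  - by rewrite mxE.
  - by rewrite mxE /= addrK.
  - by rewrite mxE /= addrK.
apply: shear_sumD; first by apply: shear_sumD; exact: shear_sum_hamiltonian.
apply: shear_sum1; first by apply: order_geD => //; exact: order_ge_mderivS.
apply: invariant_along_delta.
have e2 : d1 (d2 G) = d1 (h 0 i1) + d0 (h 0 i0).
  by rewrite GE mderivD -FE; congr (_ + _); exact: mderiv_comm.
rewrite -divh mderivD.
rewrite [d2 (d1 G)]mderiv_comm.
rewrite e2.
by rewrite addrC [d1 _ + _]addrC.
Qed.

(** The brackets of successive shears simply add up, since each intermediate field keeps the linear
    part [shift_field]: a bracket of order [k >= 2] cannot change it. *)
Lemma shear_sum_conjugacy k (P F : 'rV[T]_3) : (2 <= k)%N -> shear_sum k F ->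
  (forall i, order_ge 2 (P 0 i - shift_field 0 i)) ->
  exists Psi Phi Q, volume_conjugacy P Psi Phi Q /\
    forall i, order_ge k.+1 ((Q - P - bracket shift_field F) 0 i).
Proof.
move=> k2 + P2; elim=> [|F' f a F'k [Psi [Phi [Q [c QE]]]] fk fa].
  exists (idmap R 3), (idmap R 3), P; split; first exact: volume_conjugacy_refl.
  move=> i; have -> : P - P - bracket shift_field 0 = 0; last by rewrite mxE; exact: order_ge0.
  rewrite bracket_shift_field subrr sub0r; apply/rowP; move: i => _; apply: ord3P;
    by rewrite !mxE /= raddf0 ?subr0 oppr0.
have Q2 i : order_ge 2 (Q 0 i - shift_field 0 i).
  have -> : Q 0 i - shift_field 0 i = (Q - P - bracket shift_field F') 0 i +
      (P 0 i - shift_field 0 i) + bracket shift_field F' 0 i.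
    by rewrite !mxE; ring.
  apply: order_geD; first apply: order_geD => //.
    by apply: order_geW (QE i); exact: leqW.
  apply: (order_geW k2); have F'o := shear_sum_order F'k.
  rewrite bracket_shift_field; move: i; apply: ord3P; rewrite mxE /=;
    rewrite ?raddfB; try apply: order_geB; rewrite //; exact: order_ge_nilder.
have := volume_conjugacy_shear Q k2 fk fa.
have := shear_bracket a k2 fk shift_fieldE Q2.
set Q' := map_mx _ _ => Q'E c'.
exists (map_mx (comp_mpoly [tuple Psi 0 j | j < 3]) (idmap R 3 + f *: cst_row a)).
exists (map_mx (comp_mpoly [tuple (idmap R 3 - f *: cst_row a) 0 j | j < 3]) Phi).
exists Q'; split; first exact: volume_conjugacy_trans c c'.
by rewrite bracketD; exact: order_ge_split QE Q'E.
Qed.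

Theorem polynomial_normal_form k (P : 'rV[T]_3) : (2 <= k)%N ->
  (forall i, order_ge 2 (P 0 i - shift_field 0 i)) -> divg P = 0 ->
  exists Psi Phi Q p, [/\ volume_conjugacy P Psi Phi Q, order_ge 2 p, d2 p = 0 &
    forall i, order_ge k ((Q - shift_field - row3 0 0 p) 0 i)].
Proof.
elim: k => // k IH; rewrite leq_eqVlt => /orP[/eqP <- P2 divP|k2 P2 divP].
  exists (idmap R 3), (idmap R 3), P, 0; split.
  - exact: volume_conjugacy_refl.
  - exact: order_ge0.
  - exact: raddf0.
  - by move=> i; have := P2 i; rewrite row3_0 subr0 row_subE.
have [Psi [Phi [Q [p [c p2 dp Qk]]]]] := IH k2 P2 divP.
pose b := Q - shift_field - row3 0 0 p.
(* The divergence vanishes exactly, as [homological_equation] demands: that of [Q] by [conj_div],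
   that of the normal form because [p] is free of z. *)
have divb : divg b = 0.
  rewrite !divgB !divg_row3 (conj_div c divP) dp !mderivXU !raddf0.
  by rewrite !addr0 !subr0.
have [h [p' [hk divh p'k dp' hE]]] := homological_equation Qk divb.
have Q2 i : order_ge 2 (Q 0 i - shift_field 0 i).
  have -> : Q 0 i - shift_field 0 i = b 0 i + row3 0 0 p 0 i by rewrite !mxE; ring.
  apply: order_geD; first exact: order_geW (Qk i).
  by move: i; apply: ord3P; rewrite mxE //=; exact: order_ge0.
have [Psi' [Phi' [Q' [c' Q'E]]]] :=
  shear_sum_conjugacy k2 (divfree_shear_sum hk divh) Q2.
exists (map_mx (comp_mpoly [tuple Psi 0 j | j < 3]) Psi').
exists (map_mx (comp_mpoly [tuple Phi' 0 j | j < 3]) Phi).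
exists Q', (p + p'); split.
- exact: volume_conjugacy_trans c c'.
- by apply: order_geD => //; exact: order_geW p'k.
- by rewrite raddfD /= dp dp' addr0.
have rD : row3 0 0 (p + p') = row3 0 0 p + row3 0 0 p' by rewrite row3D !addr0.
by move=> i; rewrite rD (subr_residual _ hE); exact: Q'E.
Qed.

End HomologicalEquation.

(** * Polynomial maps as smooth functions *)

Section PolynomialMaps.
Variable R : realType.
Local Notation T := (mpoly 3 R).
Local Notation rV := 'rV[R]_3.
Implicit Types (p q : T) (F G : 'rV[T]_3) (x y : rV) (i j l : 'I_3).

Lemma coord_le_norm n (x : 'rV[R]_n) (i : 'I_n) : `|x 0 i| <= `|x|.
Proof.
rewrite [leRHS]/Num.Def.normr /= mx_normrE.
exact: (le_bigmax _ (fun ij => `|x ij.1 ij.2|) (0, i)).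
Qed.

Lemma norm_row_le n (x : 'rV[R]_n) (c : R) :
  0 <= c -> (forall i : 'I_n, `|x 0 i| <= c) -> `|x| <= c.
Proof.
move=> c0 xc; rewrite [leLHS]/Num.Def.normr /= mx_normrE bigmax_le // => -[i j] _.
by rewrite ord1.
Qed.

Definition peval p x : R := meval (fun i => x 0 i) p.

Lemma is_derive_coord n (x v : 'rV[R]_n) (i : 'I_n) : is_derive x v (fun y : 'rV[R]_n => y 0 i) (v 0 i).
Proof.
have idv := @derivable_id R ('rV[R]_n) x v.
split; first exact: (derivable_mxP id x v).1.
have := derive_mx idv; rewrite derive_id => /(congr1 (fun A : 'rV[R]_n => A 0 i)).
by rewrite mxE => <-.
Qed.

Lemma is_derive_peval p x j : is_derive x (ev R j) (peval p) (peval (mderiv j p) x).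
Proof.
move: p; apply: mpoly_ring_ind => [c|i|p q hp hq|p q hp hq].
- have -> : peval (mpolyC 3 c) = cst c by apply/funext => y; rewrite /peval mevalC.
  by rewrite mderivC /peval meval0; exact: is_derive_cst.
- have -> : peval (mpolyX R (mnm1 i)) = fun y => y 0 i.
    by apply/funext => y; rewrite /peval mevalXU.
  have -> : peval (mderiv j (mpolyX R (mnm1 i))) x = ev R j 0 i.
    by rewrite mderivXU /peval -mpolyC_nat mevalC mxE eqxx eq_sym.
  exact: is_derive_coord.
- have -> : peval (p + q) = peval p + peval q.
    by apply/funext => y; rewrite /peval mevalD.
  by rewrite mderivD /peval mevalD; exact: is_deriveD.
have -> : peval (p * q) = peval p * peval q.
  by apply/funext => y; rewrite /peval mevalM.
have -> : peval (mderiv j (p * q)) x =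
    peval p x *: peval (mderiv j q) x + peval q x *: peval (mderiv j p) x.
  by rewrite mderivM /peval mevalD !mevalM addrC; congr (_ + _); exact: mulrC.
exact: is_deriveM.
Qed.

Lemma continuous_peval p : continuous (peval p).
Proof.
move: p; apply: mpoly_ring_ind => [c|i|p q hp hq|p q hp hq] x.
- have -> : peval (mpolyC 3 c) = cst c by apply/funext => y; rewrite /peval mevalC.
  exact: cst_continuous.
- have -> : peval (mpolyX R (mnm1 i)) = fun y : rV => y 0 i.
    by apply/funext => y; rewrite /peval mevalXU.
  exact: coord_continuous.
- have -> : peval (p + q) = peval p \+ peval q.
    by apply/funext => y; rewrite /peval mevalD.
  by apply: continuousD; [exact: hp | exact: hq].
have -> : peval (p * q) = peval p \* peval q.
  by apply/funext => y; rewrite /peval mevalM.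
by apply: continuousM; [exact: hp | exact: hq].
Qed.

Definition polymap F x : rV := map_mx (fun p => peval p x) F.

Lemma polymapE F x i : polymap F x 0 i = peval (F 0 i) x.
Proof. by rewrite mxE. Qed.

Lemma derivable_polymap F x j : derivable (polymap F) x (ev R j).
Proof.
apply/derivable_mxP => i l.
have -> : (fun y => polymap F y i l) = peval (F i l) by apply/funext => y; rewrite mxE.
by have [] := is_derive_peval (F i l) x j.
Qed.

Lemma partial_polymap F j : partial j (polymap F) = polymap (map_mx (mderiv j) F).
Proof.
apply/funext => x; rewrite /partial (derive_mx (@derivable_polymap F x j)).
apply/matrixP => i l; rewrite !mxE.
have -> : (fun y => polymap F y i l) = peval (F i l) by apply/funext => y; rewrite mxE.
by have [] := is_derive_peval (F i l) x j.
Qed.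

Lemma continuous_mx (V : topologicalType) m n (f : V -> 'M[R]_(m, n)) (x : V) :
  (forall (i : 'I_m) (j : 'I_n), {for x, continuous (fun y : V => f y i j)}) -> {for x, continuous f}.
Proof.
move=> fc; apply/cvgrPdist_le => e e0.
near=> y; rewrite [leLHS]/Num.Def.normr /= mx_normrE bigmax_le ?(ltW e0) //= => ij _.
rewrite !mxE; move: ij; near: y; apply: filter_forall => ij.
exact: ((cvgrPdist_le _ _).1 (fc ij.1 ij.2)).
Unshelve. all: by end_near. Qed.

Lemma continuous_polymap F : continuous (polymap F).
Proof.
move=> x; apply: continuous_mx => i j.
have -> : (fun y => polymap F y i j) = peval (F i j) by apply/funext => y; rewrite mxE.
exact: continuous_peval.
Qed.

Lemma iter_partial_polymap s F :
  iter_partial s (polymap F) = polymap (foldr (fun i G => map_mx (mderiv i) G) F s).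
Proof. by elim: s => //= i s ->; rewrite partial_polymap. Qed.

Lemma smooth_polymap V F : smooth_on V (polymap F).
Proof.
move=> s x _; rewrite iter_partial_polymap; split.
  by move=> i; exact: derivable_polymap.
exact: continuous_polymap.
Qed.

Lemma jacmx_polymap F x : jacmx (polymap F) x = (map_mx (fun p => peval p x) (jactr F))^T.
Proof. by apply/matrixP => i j; rewrite mxE partial_polymap !mxE. Qed.

Lemma peval_subst F p x :
  peval (comp_mpoly [tuple F 0 j | j < 3] p) x = peval p (polymap F x).
Proof.
rewrite /peval comp_mpoly_meval; apply: meval_eq => i.
by rewrite tnth_mktuple mxE.
Qed.

Lemma polymap_comp F G x : polymap (map_mx (comp_mpoly [tuple F 0 j | j < 3]) G) x =
  polymap G (polymap F x).
Proof. by apply/rowP => i; rewrite !mxE peval_subst. Qed.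

Lemma polymap_idmap x : polymap (idmap R 3) x = x.
Proof. by apply/rowP => i; rewrite !mxE /peval mevalXU. Qed.

Lemma peval_bound k p : order_ge k p ->
  exists2 C, 0 <= C & forall x, `|x| <= 1 -> `|peval p x| <= C * `|x| ^+ k.
Proof.
move: p; apply: order_ge_ind.
- exists 0 => // x _; by rewrite /peval meval0 normr0 mul0r.
- move=> p q [C C0 pC] [C' C'0 qC']; exists (C + C'); first exact: addr_ge0.
  move=> x x1; rewrite /peval mevalD mulrDl; apply: le_trans (ler_normD _ _) _.
  by apply: lerD; [exact: pC | exact: qC'].
move=> c m km; exists `|c|; first exact: normr_ge0.
move=> x x1; rewrite /peval mevalZ mevalX normrM ler_wpM2l //.
apply: (@le_trans _ _ (`|x| ^+ mdeg m)); last exact: ler_wiXn2l.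
rewrite normr_prod mdegE expr_sum.
apply: ler_prod => i _; rewrite normrX exprn_ge0 //=.
by apply: lerXn2r => //; rewrite ?nnegrE //; exact: coord_le_norm.
Qed.

End PolynomialMaps.

(** * Smooth maps: mean value theorem and symmetry of second derivatives *)

Section SmoothMaps.
Variable R : realType.
Local Notation rV := 'rV[R]_3.
Implicit Types (U : set rV) (f g : rV -> rV) (x y w : rV) (i j l : 'I_3) (s : seq 'I_3).

Lemma is_derive_line f x j l t : derivable f (x + t *: ev R j) (ev R j) ->
  is_derive t (1 : R) (fun t => f (x + t *: ev R j) 0 l) (partial j f (x + t *: ev R j) 0 l).
Proof.
move=> df; pose fl (y : rV) := f y 0 l.
have dfl : derivable fl (x + t *: ev R j) (ev R j) by exact: (derivable_mxP _ _ _).1.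
have quot : (fun h : R => h^-1 *: (((fun t => fl (x + t *: ev R j)) \o shift t) (h *: 1)
    - fl (x + t *: ev R j))) =
  (fun h : R => h^-1 *: ((fl \o shift (x + t *: ev R j)) (h *: ev R j)
    - fl (x + t *: ev R j))).
  apply/funext => h; congr (_ *: (fl _ - _)) => /=.
  by rewrite [h *: 1]mulr1 scalerDl addrCA.
split; first by rewrite /derivable quot.
rewrite [LHS]/derive quot /partial (derive_mx df) mxE; by [].
Qed.

(* The point [t] may be negative, hence the bounds on [`|c|]. *)
Lemma mvt_coord f x j l (t : R) :
  (forall c : R, `|c| <= `|t| -> derivable f (x + c *: ev R j) (ev R j)) ->
  exists2 c, `|c| <= `|t| &
    (f (x + t *: ev R j) - f x) 0 l = t * partial j f (x + c *: ev R j) 0 l.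
Proof.
move=> df; pose g (c : R) : R := f (x + c *: ev R j) 0 l.
pose dg (c : R) : R := partial j f (x + c *: ev R j) 0 l.
have gE (c : R) : `|c| <= `|t| -> is_derive c (1 : R) g (dg c).
  by move=> ct; apply: is_derive_line; exact: df.
have mvt (a b : R) : a <= b -> (forall c : R, a <= c <= b -> `|c| <= `|t|) ->
    exists2 c, c \in `[a, b] & g b - g a = dg c * (b - a).
  move=> ab abt; apply: MVT_segment => // [c|].
    by rewrite in_itv /= => /andP[/ltW ac /ltW cb]; apply: gE; apply: abt; rewrite ac.
  apply: derivable_within_continuous => c; rewrite in_itv /= => cab.
  by have [] := gE c (abt c cab).
have g0 : g 0 = f x 0 l by rewrite /g scale0r addr0.
have gB : (f (x + t *: ev R j) - f x) 0 l = g t - g 0 by rewrite g0 !mxE.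
rewrite gB; have [t0|t0] := leP 0 t.
  have [|c] := mvt 0 t t0.
    by move=> c /andP[c0 ct]; rewrite !ger0_norm.
  rewrite in_itv /= => /andP[c0 ct] ->; rewrite subr0 mulrC; exists c => //.
  by rewrite !ger0_norm.
have [|c] := mvt t 0 (ltW t0).
  by move=> c /andP[ct c0]; rewrite !ler0_norm ?lerN2 // ltW.
rewrite in_itv /= => /andP[ct c0] e; exists c; first by rewrite !ler0_norm ?lerN2 // ltW.
by rewrite -[LHS]opprB e sub0r mulrN opprK mulrC.
Qed.

Lemma smooth_partial U f i : smooth_on U f -> smooth_on U (partial i f).
Proof.
move=> fU s x Ux.
have -> : iter_partial s (partial i f) = iter_partial (rcons s i) f.
  by rewrite /iter_partial foldr_rcons.
exact: fU.
Qed.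

Lemma smooth_iter U f s : smooth_on U f -> smooth_on U (iter_partial s f).
Proof. by move=> fU; elim: s => [//|i s IH]; exact: (smooth_partial i IH). Qed.

Lemma smooth_derivable U f x i : smooth_on U f -> U x -> derivable f x (ev R i).
Proof. by move=> fU Ux; have [/(_ i)] := fU [::] x Ux. Qed.

Lemma smooth_continuous U f x : smooth_on U f -> U x -> {for x, continuous f}.
Proof. by move=> fU Ux; have [] := fU [::] x Ux. Qed.

Lemma derivable_translate f x w v : derivable f (x + w) v ->
  derivable (fun y => f (y + w)) x v /\ 'D_v (fun y => f (y + w)) x = 'D_v f (x + w).
Proof.
have quot : (fun h : R => h^-1 *: (((fun y => f (y + w)) \o shift x) (h *: v)
    - f (x + w))) =
  (fun h : R => h^-1 *: ((f \o shift (x + w)) (h *: v) - f (x + w))).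
  by apply/funext => h; rewrite /= addrA.
by move=> df; rewrite /derivable /derive quot.
Qed.

Lemma open_ball_norm U x : open U -> U x ->
  exists2 r : R, 0 < r & forall y, `|y - x| < r -> U y.
Proof.
move=> oU Ux; have /nbhs_ballP[r r0 rU] : nbhs x U by exact: open_nbhs_nbhs.
exists r => // y yx; apply: rU.
by rewrite mx_norm_ball /ball_ /= distrC.
Qed.

Lemma norm_ev j : `|ev R j| <= 1.
Proof.
by apply: norm_row_le => // l; rewrite mxE; case: (_ && _); rewrite ?normr1 ?normr0.
Qed.

Definition second_difference f x i j (h : R) :=
  f (x + h *: ev R i + h *: ev R j) - f (x + h *: ev R i) - (f (x + h *: ev R j) - f x).

Lemma second_differenceC f x i j h : second_difference f x i j h = second_difference f x j i h.
Proof.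
rewrite /second_difference [x + h *: ev R j + _]addrAC.
move: (f (x + h *: ev R i + _)) (f (x + h *: ev R i)) (f (x + h *: ev R j)) => a b c.
by rewrite !opprB !addrA [RHS]addrAC [a - c - b]addrAC [RHS]addrAC.
Qed.

(** The second difference is the increment along [ev R i] of [g], the increment of [f] along
    [ev R j]. The mean value theorem is applied to [g], then to the difference of [partial i f] that
    results. *)
Lemma second_difference_mvt f x i j l h :
  0 < h -> (forall y, `|y - x| <= 2 * h -> forall k, derivable f y (ev R k) /\
     derivable (partial i f) y (ev R k)) ->
  exists2 z, `|z - x| <= 2 * h &
    second_difference f x i j h 0 l = h * (h * partial j (partial i f) z 0 l).
Proof.
move=> h0 df; pose g := (fun y => f (y + h *: ev R j)) - f.
have ceh c k : `|c| <= h -> `|c *: ev R k| <= h.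
  by move=> ch; rewrite normrZ -[h]mulr1; apply: ler_pM => //; exact: norm_ev.
have near2 c d k : `|c| <= h -> `|d| <= h ->
    `|x + c *: ev R i + d *: ev R k - x| <= 2 * h.
  move=> ch dh; rewrite addrAC [x + _]addrC addrK mulr_natl mulr2n.
  by apply: le_trans (ler_normD _ _) _; apply: lerD; exact: ceh.
have near1 c : `|c| <= h -> `|x + c *: ev R i - x| <= 2 * h.
  by move=> ch; have := near2 c 0 i ch; rewrite scale0r addr0 normr0; apply; exact: ltW.
have dg c : `|c| <= h -> derivable g (x + c *: ev R i) (ev R i) /\
    partial i g (x + c *: ev R i) = partial i f (x + c *: ev R i + h *: ev R j)
      - partial i f (x + c *: ev R i).
  move=> ch; have hh : `|h| <= h by rewrite gtr0_norm.
  have [d1 e1] := derivable_translate (df _ (near2 c h j ch hh) i).1.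
  have [d2 _] := df _ (near1 c ch) i.
  split; first exact: (derivableB d1 d2).
  by rewrite /partial (deriveB d1 d2) e1.
have [|c ch ce] := @mvt_coord g x i l h.
  by move=> c; rewrite (gtr0_norm h0) => ch; exact: (dg c ch).1.
rewrite (gtr0_norm h0) in ch.
have [|d dh de] := @mvt_coord (partial i f) (x + c *: ev R i) j l h.
  move=> d; rewrite (gtr0_norm h0) => dh.
  exact: (df _ (near2 c d j ch dh) j).2.
rewrite (gtr0_norm h0) in dh.
exists (x + c *: ev R i + d *: ev R j); first exact: near2.
have -> : second_difference f x i j h = g (x + h *: ev R i) - g x by [].
by rewrite ce (dg c ch).2 de.
Qed.

Lemma dist_le_halves (a b u w e : R) :
  u = w -> `|a - u| <= e / 2 -> `|b - w| <= e / 2 -> `|a - b| <= e.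
Proof.
move=> <- au bu; rewrite -(subrKA u) [e]splitr (le_trans (ler_normD _ _)) // lerD //.
by rewrite distrC.
Qed.

(** The second difference is symmetric in i and j, so the two mixed derivatives agree at two points
    near [x], and continuity brings both to [x]. This is needed because Taylor coefficients are
    indexed by monomials, [smooth_on] by ordered sequences of derivatives. *)
Lemma schwarz U f x i j : open U -> smooth_on U f -> U x ->
  partial i (partial j f) x = partial j (partial i f) x.
Proof.
move=> oU fU Ux; apply/rowP => l; apply/eqP; rewrite -subr_eq0 -normr_le0.
apply/ler_addgt0Pr => e e0; rewrite add0r.
have [r r0 rU] := open_ball_norm oU Ux.
have cont a b : exists2 d : R, 0 < d & forall z, `|z - x| < d ->
    `|partial a (partial b f) x 0 l - partial a (partial b f) z 0 l| <= e / 2.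
  have := smooth_continuous (smooth_partial a (smooth_partial b fU)) Ux.
  have e20 : 0 < e / 2 by rewrite divr_gt0.
  move=> /cvgrPdist_le /(_ _ e20) /nbhs_ballP[d d0 dE]; exists d => // z zx.
  apply: le_trans (dE z _); last by rewrite mx_norm_ball /ball_ /= distrC.
  by have := coord_le_norm (partial a (partial b f) x - partial a (partial b f) z) l;
    rewrite !mxE.
have [d1 d10 d1E] := cont i j; have [d2 d20 d2E] := cont j i.
(* With step [m / 4] the intermediate points lie within [m / 2] of [x], inside the domain and both
   continuity balls. *)
pose m := Num.min r (Num.min d1 d2).
have m0 : 0 < m by rewrite !lt_min r0 d10.
have h0 : 0 < m / 4 by rewrite divr_gt0.
have hm : 2 * (m / 4) < m by rewrite mulrA ltr_pdivrMr // [2 * m]mulrC ltr_pM2l // ltr_nat.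
have hr y : `|y - x| <= 2 * (m / 4) -> `|y - x| < m by move=> /le_lt_trans; apply.
have df a y : `|y - x| <= 2 * (m / 4) ->
   forall k, derivable f y (ev R k) /\ derivable (partial a f) y (ev R k).
  move=> /hr; rewrite lt_min => /andP[yr _] k.
  split; first exact: (smooth_derivable fU (rU _ yr)).
  exact: (smooth_derivable (smooth_partial a fU) (rU _ yr)).
have [z1 z1x e1] := @second_difference_mvt f x j i l _ h0 (df j).
have [z2 z2x e2] := @second_difference_mvt f x i j l _ h0 (df i).
move: e1; rewrite second_differenceC e2 => /(mulfI (lt0r_neq0 h0)) /(mulfI (lt0r_neq0 h0)) e12.
move: (hr _ z1x) (hr _ z2x); rewrite !lt_min => /and3P[_ z1d _] /and3P[_ _ z2d].
exact: (dist_le_halves (esym e12) (d1E _ z1d) (d2E _ z2d)).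
Qed.

Lemma eq_partial U f g x i : open U -> (forall y, U y -> f y = g y) -> U x ->
  partial i f x = partial i g x.
Proof.
move=> oU fg Ux; apply: near_eq_derive; near=> y; apply: fg; near: y.
exact: open_nbhs_nbhs.
Unshelve. all: by end_near. Qed.

Lemma iter_partial_move U f s1 s2 i x : open U -> smooth_on U f -> U x ->
  iter_partial (s1 ++ i :: s2) f x = iter_partial (i :: s1 ++ s2) f x.
Proof.
move=> oU fU; elim: s1 x => [x _|a s1 IH x Ux]; first exact: erefl.
rewrite [LHS](eq_partial a oU IH Ux).
exact: (schwarz a i oU (smooth_iter (s1 ++ s2) fU) Ux).
Qed.

Lemma iter_partial_perm U f s s' x : open U -> smooth_on U f -> U x ->
  perm_eq s s' -> iter_partial s f x = iter_partial s' f x.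
Proof.
move=> oU fU; elim: s s' x => [|i s IH] s' x Ux; first by rewrite perm_sym => /perm_nilP ->.
move=> ss'; have : i \in s' by rewrite -(perm_mem ss') mem_head.
move=> /path.splitPr is'; case: is' ss' => l r.
rewrite perm_sym -cat1s perm_catCA perm_cons perm_sym => slr.
rewrite (iter_partial_move l r i oU fU Ux).
apply: (eq_partial i oU) Ux => y Uy; exact: IH.
Qed.

Lemma iter_partialB U f g s x : open U -> smooth_on U f -> smooth_on U g -> U x ->
  iter_partial s (f - g) x = iter_partial s f x - iter_partial s g x.
Proof.
move=> oU fU gU; elim: s x => // i s IH x Ux.
rewrite [LHS](@eq_partial U _ (iter_partial s f - iter_partial s g)) //.
by rewrite /partial deriveB //; apply: smooth_derivable Ux; exact: smooth_iter.
Qed.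

Lemma smooth_onB U f g : open U -> smooth_on U f -> smooth_on U g -> smooth_on U (f - g).
Proof.
move=> oU fU gU s x Ux; have fs := smooth_iter s fU; have gs := smooth_iter s gU.
have E : {near x, iter_partial s f - iter_partial s g =1 iter_partial s (f - g)}.
  near=> y; apply/esym; apply: (iter_partialB s oU fU gU); near: y.
  exact: open_nbhs_nbhs.
split=> [i|].
  apply: near_eq_derivable E _.
  exact: (derivableB (smooth_derivable fs Ux) (smooth_derivable gs Ux)).
rewrite /prop_for /continuous_at (iter_partialB s oU fU gU Ux).
apply: cvg_trans (near_eq_cvg E) _.
exact: (continuousB (smooth_continuous fs Ux) (smooth_continuous gs Ux)).
Unshelve. all: by end_near. Qed.

End SmoothMaps.

(** * Taylor polynomials and their remainder *)

Section Taylor.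
Variable R : realType.
Local Notation rV := 'rV[R]_3.
Local Notation T := (mpoly 3 R).
Implicit Types (U : set rV) (f g : rV -> rV) (x y w : rV) (i j l : 'I_3) (s : seq 'I_3).

Lemma mvt_norm f x j (t rho M : R) : `|t| <= rho -> 0 <= M ->
  (forall c : R, `|c| <= `|t| -> `|x + c *: ev R j| <= rho) ->
  (forall z, `|z| <= rho -> derivable f z (ev R j) /\ `|partial j f z| <= M) ->
  `|f (x + t *: ev R j) - f x| <= M * rho.
Proof.
move=> trho M0 xrho fM; apply: norm_row_le => [|l].
  by rewrite mulr_ge0 // (le_trans _ trho).
have [|c ct ->] := @mvt_coord R f x j l t.
  by move=> c ct; exact: (fM _ (xrho c ct)).1.
rewrite normrM mulrC; apply: ler_pM => //.
exact: le_trans (coord_le_norm _ _) (fM _ (xrho c ct)).2.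
Qed.

(** Go from 0 to [x] in three legs parallel to the axes, whence the factor 3; the path stays in the
    ball because the norm is the maximum of the coordinates. *)
Lemma norm_partial_bound f (rho M : R) : 0 <= M -> f 0 = 0 ->
  (forall z, `|z| <= rho -> forall j, derivable f z (ev R j) /\ `|partial j f z| <= M) ->
  forall x, `|x| <= rho -> `|f x| <= 3 * M * rho.
Proof.
move=> M0 f0 fM x xrho.
have rho0 : 0 <= rho by exact: le_trans xrho.
have xl l : `|x 0 l| <= rho by exact: le_trans (coord_le_norm _ _) xrho.
pose x1 := 0 + x 0 i0 *: ev R i0.
pose x2 := x1 + x 0 i1 *: ev R i1.
have x3 : x = x2 + x 0 i2 *: ev R i2.
  apply/rowP; apply: ord3P; rewrite !mxE /= ?mulr1 ?mulr0 ?addr0 ?add0r //.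
have step y j : (forall l, `|y 0 l| <= rho) -> y 0 j = 0 ->
    `|f (y + x 0 j *: ev R j) - f y| <= M * rho.
  move=> yrho yj; apply: mvt_norm => // [c ct|z zrho]; last exact: fM.
  apply: norm_row_le => // l; rewrite !mxE /=; have [->|lj] := eqVneq l j.
    by rewrite yj mulr1 add0r (le_trans ct).
  by rewrite mulr0 addr0.
have s1 : `|f x1 - f 0| <= M * rho.
  by apply: step => [l|]; rewrite mxE ?normr0.
have s2 : `|f x2 - f x1| <= M * rho.
  apply: step; first apply: ord3P; rewrite !mxE /= ?mulr1 ?mulr0 ?add0r ?addr0 ?normr0 //.
have s3 : `|f x - f x2| <= M * rho.
  rewrite {1}x3; apply: step; first apply: ord3P;
    rewrite !mxE /= ?mulr1 ?mulr0 ?add0r ?addr0 ?normr0 //.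
have -> : f x = (f x - f x2) + (f x2 - f x1) + (f x1 - f 0).
  by rewrite f0 subr0 addrA !subrK.
have -> : 3 * M * rho = M * rho + M * rho + M * rho by ring.
apply: le_trans (ler_normD _ _) _; apply: lerD => //.
by apply: le_trans (ler_normD _ _) _; exact: lerD.
Qed.

(** Induction on [n] instead of a remainder formula: the first partial derivatives are O(|x|^n) by
    induction, and [norm_partial_bound] on the ball of radius |x| gains one power. The base case is
    local boundedness. *)
Lemma vanishing_partials_Oh U f n : open U -> U 0 -> smooth_on U f ->
  (forall s, (size s < n)%N -> iter_partial s f 0 = 0) -> Oh_at0 f n.
Proof.
move=> oU U0; elim: n f => [|n IH] f fU f0.
  have /cvgrPdist_le /(_ _ ltr01) /nbhs_ballP[e e0 fe] := smooth_continuous fU U0.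
  exists (1 + `|f 0|), e; split => // x xe; rewrite expr0 mulr1.
  have := fe x; rewrite mx_norm_ball /ball_ /= sub0r normrN => /(_ xe) fx.
  rewrite -[f x](subrK (f 0)); apply: le_trans (ler_normD _ _) _.
  by rewrite lerD2r distrC.
have Ohj j : Oh_at0 (partial j f) n.
  apply: IH; first exact: smooth_partial.
  move=> s sn; have -> : iter_partial s (partial j f) = iter_partial (rcons s j) f.
    by rewrite /iter_partial foldr_rcons.
  by apply: f0; rewrite size_rcons.
have [C0 [e0 [e00 h0]]] := Ohj i0; have [C1 [e1 [e10 h1]]] := Ohj i1.
have [C2 [e2 [e20 h2]]] := Ohj i2.
have [r r0 rU] := open_ball_norm oU U0.
pose C := `|C0| + `|C1| + `|C2|; pose e := Num.min r (Num.min e0 (Num.min e1 e2)).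
exists (3 * C), e; split; first by rewrite !lt_min r0 e00 e10.
have C_ge0 : 0 <= C by rewrite !addr_ge0.
move=> x xe; rewrite exprSr mulrA -[3 * C * _]mulrA.
apply: norm_partial_bound => //.
- by rewrite mulr_ge0 // exprn_ge0.
- exact: (f0 [::]).
move=> z zx j; have := le_lt_trans zx xe; rewrite !lt_min => /and4P[zr z0 z1 z2].
have Uz : U z by apply: rU; rewrite subr0.
split; first exact: (smooth_derivable fU Uz).
have bound c : c <= C -> c * `|z| ^+ n <= C * `|x| ^+ n.
  move=> cC; apply: (@le_trans _ _ (C * `|z| ^+ n)).
    by apply: ler_wpM2r => //; exact: exprn_ge0.
  by apply: ler_wpM2l => //; apply: lerXn2r => //; rewrite nnegrE.
move: j; apply: ord3P.
- apply: le_trans (h0 _ z0) (bound _ _); apply: le_trans (ler_norm _) _.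
  by rewrite /C -addrA lerDl addr_ge0.
- apply: le_trans (h1 _ z1) (bound _ _); apply: le_trans (ler_norm _) _.
  by rewrite /C addrAC lerDr addr_ge0.
- apply: le_trans (h2 _ z2) (bound _ _); apply: le_trans (ler_norm _) _.
  by rewrite /C lerDr addr_ge0.
Qed.

(** The sorted order of differentiation for a multi-index; every other order is a permutation of it
    and gives the same derivative. *)
Definition mnm_seq (m : multinom 3) : seq 'I_3 :=
  flatten [seq nseq (m i) i | i <- enum 'I_3].

Lemma count_mnm_seq m i : count_mem i (mnm_seq m) = m i.
Proof.
rewrite count_flatten sumnE !big_map -enumT big_enum /= (bigD1 i) //= big1 ?addn0.
  by rewrite count_nseq /= eqxx mul1n.
by move=> j ji; rewrite count_nseq /= (negPf ji).
Qed.

Lemma perm_mnm_seq s : exists m, perm_eq s (mnm_seq m).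
Proof.
exists (Multinom [tuple count_mem i s | i < 3]).
apply/allP => i _; apply/eqP; rewrite count_mnm_seq.
by rewrite /fun_of_multinom /= tnth_mktuple.
Qed.

Lemma size_mnm_seq m : size (mnm_seq m) = mdeg m.
Proof.
rewrite /mnm_seq size_flatten sumnE !big_map -enumT big_enum /= mdegE.
by apply: eq_bigr => i _; rewrite /= size_nseq.
Qed.

Lemma peval0 (p : T) : peval p 0 = mcoeff mnm0 p.
Proof.
rewrite /peval mevalE; have [p0|p0] := boolP (mnm0 \in msupp p).
  rewrite (big_rem _ p0) /= big1 => [|i _]; last by rewrite mnm0E.
  rewrite mulr1 big_seq big1 ?addr0 // => m.
  rewrite mem_rem_uniq // inE => /andP[m0 _].
  have /existsP[i mi] : [exists i, m i != 0%N].
    apply: contraR m0 => /existsPn m0; apply/eqP/mnmP => i.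
    by rewrite mnm0E; apply/eqP; move: (m0 i); rewrite negbK.
  by rewrite (bigD1 i) //= mxE expr0n (negPf mi) mul0r mulr0.
rewrite memN_msupp_eq0 // big_seq big1 // => m mp.
have /existsP[i mi] : [exists i, m i != 0%N].
  apply: contraR p0 => /existsPn m0; suff <- : m = mnm0 by [].
  by apply/mnmP => i; rewrite mnm0E; apply/eqP; move: (m0 i); rewrite negbK.
by rewrite (bigD1 i) //= mxE expr0n (negPf mi) mul0r mulr0.
Qed.

Definition mfact (m : multinom 3) : R := (\prod_(i < 3) (m i)`!)%N%:R.

Lemma iter_partial_polymap0 m (F : 'rV[T]_3) l :
  iter_partial (mnm_seq m) (polymap F) 0 0 l = mfact m * mcoeff m (F 0 l).
Proof.
rewrite iter_partial_polymap polymapE.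
have -> : forall s, foldr (fun i (G : 'rV[T]_3) => map_mx (mderiv i) G) F s 0 l
    = foldr (@mderiv 3 R) (F 0 l) s.
  by elim=> //= i s <-; rewrite mxE.
rewrite -(mderivm_foldr m) peval0 mcoeff_mderivm addm0 -mulr_natl; congr (_%:R * _).
by apply: eq_bigr => i _; rewrite ffactnn.
Qed.

Lemma mfact_neq0 m : mfact m != 0.
Proof. by rewrite pnatr_eq0 -lt0n prodn_gt0 // => i; exact: fact_gt0. Qed.

Lemma taylor_polynomial U f n : open U -> U 0 -> smooth_on U f ->
  exists F : 'rV[T]_3, forall s, (size s <= n)%N -> iter_partial s (f - polymap F) 0 = 0.
Proof.
move=> oU U0 fU.
pose c l m := iter_partial (mnm_seq m) f 0 0 l / mfact m.
(* The index type bounds degrees strictly, so [n.+1] means degrees up to [n]. *)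
pose F : 'rV[T]_3 := \row_l \sum_(m : bmultinom 3 n.+1) c l m *: mpolyX R m.
exists F => s sn; have [m sm] := perm_mnm_seq s.
have pU := @smooth_polymap R U F.
have fFU : smooth_on U (f - polymap F).
  exact: smooth_onB.
rewrite (iter_partial_perm oU fFU U0 sm) (iter_partialB _ oU fU pU U0).
apply/rowP => l; rewrite [RHS]mxE row_subE iter_partial_polymap0 [F 0 l]mxE.
rewrite mcoeff_mpoly; last by rewrite ltnS -size_mnm_seq -(perm_size sm).
by rewrite /c mulrC divfK ?subrr // mfact_neq0.
Qed.

(** All derivatives of the divergence vanish. As [iter_partial] acts on vector fields only, the
    diagonal component is taken after differentiating. *)
Lemma divergence_iter U f s x : open U -> smooth_on U f ->
  (forall y, U y -> divergence f y = 0) -> U x ->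
  \sum_i iter_partial s (partial i f) x 0 i = 0.
Proof.
move=> oU fU divf; elim: s x => [x Ux|j s IH x Ux]; first exact: divf.
pose g i y := iter_partial s (partial i f) y 0 i.
have dg i : derivable (g i) x (ev R j).
  have := smooth_derivable (smooth_iter s (smooth_partial i fU)) Ux.
  by move=> d; exact: (derivable_mxP _ _ _).1 (d j) 0 i.
have -> : \sum_i iter_partial (j :: s) (partial i f) x 0 i = \sum_i 'D_(ev R j) (g i) x.
  apply: eq_bigr => i _; rewrite [iter_partial _ _]/= /partial -/(partial i f) derive_mx.
    by rewrite mxE.
  exact: (smooth_derivable (smooth_iter s (smooth_partial i fU)) Ux).
rewrite -derive_sum // -(derive_cst (0 : R) x (ev R j)).
apply: near_eq_derive; near=> y; rewrite fct_sumE; apply: IH; near: y.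
exact: open_nbhs_nbhs.
Unshelve. all: by end_near. Qed.

End Taylor.

(** * Passing between O-estimates and orders of polynomials *)

Section OhEstimates.
Variable R : realType.
Local Notation rV := 'rV[R]_3.
Local Notation T := (mpoly 3 R).
Implicit Types (U : set rV) (f g : rV -> rV) (x y : rV) (F P : 'rV[T]_3).

Lemma Oh_at0D f g k : Oh_at0 f k -> Oh_at0 g k -> Oh_at0 (fun x => f x + g x) k.
Proof.
move=> [C [e [e0 fC]]] [C' [e' [e'0 gC]]].
exists (C + C'), (Num.min e e'); split; first by rewrite lt_min e0.
move=> x; rewrite lt_min => /andP[xe xe']; apply: le_trans (ler_normD _ _) _.
by rewrite mulrDl lerD // ?fC ?gC.
Qed.

Lemma Oh_at0N f k : Oh_at0 f k -> Oh_at0 (fun x => - f x) k.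
Proof. by move=> [C [e [e0 fC]]]; exists C, e; split=> // x /fC; rewrite normrN. Qed.

Lemma Oh_at0W f k l : (l <= k)%N -> Oh_at0 f k -> Oh_at0 f l.
Proof.
move=> lk [C [e [e0 fC]]]; exists `|C|, (Num.min e 1); split; first by rewrite lt_min e0 ltr01.
move=> x; rewrite lt_min => /andP[xe x1]; apply: le_trans (fC _ xe) _.
apply: (@le_trans _ _ (`|C| * `|x| ^+ k)).
  by apply: ler_wpM2r; [exact: exprn_ge0 | exact: ler_norm].
by apply: ler_wpM2l => //; apply: ler_wiXn2l => //; exact: ltW.
Qed.

Lemma polymap_bound F k : (forall i, order_ge k (F 0 i)) ->
  exists2 C, 0 <= C & forall x, `|x| <= 1 -> `|polymap F x| <= C * `|x| ^+ k.
Proof.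
move=> Fk; have [C0 C00 h0] := peval_bound (Fk i0).
have [C1 C10 h1] := peval_bound (Fk i1); have [C2 C20 h2] := peval_bound (Fk i2).
exists (C0 + C1 + C2); first by rewrite !addr_ge0.
move=> x x1; have xk : 0 <= `|x| ^+ k by exact: exprn_ge0.
apply: norm_row_le; first by rewrite mulr_ge0 ?addr_ge0.
apply: ord3P; rewrite polymapE.
- by apply: le_trans (h0 x x1) _; apply: ler_wpM2r => //; lra.
- by apply: le_trans (h1 x x1) _; apply: ler_wpM2r => //; lra.
- by apply: le_trans (h2 x x1) _; apply: ler_wpM2r => //; lra.
Qed.

Lemma polymap_Oh F k : (forall i, order_ge k (F 0 i)) -> Oh_at0 (polymap F) k.
Proof.
move=> /polymap_bound[C _ FC]; exists C, 1; split=> // x x1.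
by apply: FC; exact: ltW.
Qed.

Lemma polymapB F P x : polymap (F - P) x = polymap F x - polymap P x.
Proof. by apply/rowP => i; rewrite !polymapE !row_subE !polymapE /peval mevalB. Qed.

(** Coefficients of degree 0 and 1 are the value and the partial derivatives at 0; a quadratic bound
    makes the value 0 and the difference quotients O(h). *)
Lemma Oh_order_ge2 F : Oh_at0 (polymap F) 2 -> forall i, order_ge 2 (F 0 i).
Proof.
move=> [C [e [e0 FC]]] i.
have FCi x : `|x| < e -> `|peval (F 0 i) x| <= C * `|x| ^+ 2.
  by move=> /FC; apply: le_trans; rewrite -polymapE; exact: coord_le_norm.
have F0 : peval (F 0 i) 0 = 0.
  by apply/eqP; rewrite -normr_le0; have := FCi 0; rewrite normr0 expr0n mulr0; apply.
move=> m; rewrite ltnS leq_eqVlt ltnS leqn0 => /orP[|].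
  rewrite mdeg_eq1 => /existsP[j /eqP ->].
  have -> : mcoeff (mnm1 j) (F 0 i) = peval (mderiv j (F 0 i)) 0.
    by rewrite peval0 mcoeff_mderiv add0m mnm0E mulr1n.
  have [_ <-] := is_derive_peval (F 0 i) 0 j.
  apply: cvg_lim => //; apply/cvgr0Pnorm_le => d d0 /=.
  (* [C] may be zero or negative; [|C| + 1] can be divided by. *)
  have C1 : 0 < `|C| + 1 by rewrite ltr_wpDl.
  near=> h; rewrite addr0 F0 subr0 normrM normfV.
  have h0 : h != 0 by near: h; exact: nbhs_dnbhs_neq.
  have hev : `|h *: ev R j| <= `|h|.
    by rewrite normrZ -[leRHS]mulr1 ler_wpM2l // norm_ev.
  rewrite mulrC ler_pdivrMr ?normr_gt0 //.
  apply: le_trans (FCi _ _) _.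
    apply: le_lt_trans hev _; near: h; exact: dnbhs0_lt.
  apply: (@le_trans _ _ ((`|C| + 1) * `|h| ^+ 2)).
    apply: (@le_trans _ _ ((`|C| + 1) * `|h *: ev R j| ^+ 2)).
      by apply: ler_wpM2r; [exact: exprn_ge0 | rewrite ler_wpDr // ler_norm].
    by apply: ler_wpM2l; [exact: ltW | apply: lerXn2r => //; rewrite nnegrE].
  rewrite expr2 mulrA ler_wpM2r // mulrC -ler_pdivlMr //.
  by near: h; apply: dnbhs0_le; rewrite divr_gt0.
by rewrite mdeg_eq0 => /eqP ->; rewrite -peval0.
Unshelve. all: by end_near. Qed.

(** [taylor_polynomial] controls [F] only up to degree D, so its divergence vanishes only to order
    D. An x-antiderivative of that divergence has order D + 1: subtracting it from the first
    component makes the divergence exactly 0 within the allowed error. *)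
Lemma divfree_taylor U v D : open U -> U 0 -> smooth_on U v ->
  (forall x, U x -> divergence v x = 0) ->
  exists2 P, divg P = 0 & Oh_at0 (fun x => v x - polymap P x) D.+1.
Proof.
move=> oU U0 vU divv; have [F FE] := taylor_polynomial D oU U0 vU.
have FU := @smooth_polymap R U F.
have rU := smooth_onB oU vU FU.
have divF : order_ge D (divg F).
  move=> m mD; apply: (mulfI (mfact_neq0 R m)); rewrite mulr0.
  rewrite /divg (raddf_sum (mcoeff m)) mulr_sumr -[RHS](divergence_iter (mnm_seq m) oU vU divv U0).
  apply: eq_bigr => i _.
  have := iter_partial_polymap0 m (map_mx (mderiv i) F) i.
  rewrite -partial_polymap mxE => <-.
  have shift g : iter_partial (mnm_seq m) (partial i g) = iter_partial (rcons (mnm_seq m) i) g.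
    by rewrite /iter_partial foldr_rcons.
  have := FE (rcons (mnm_seq m) i); rewrite size_rcons size_mnm_seq => /(_ mD).
  rewrite (iter_partialB _ oU vU FU U0) => /eqP; rewrite subr_eq0 => /eqP e.
  by rewrite !shift e.
have [q qD qE] := exists_antiderivative i0 divF.
exists (F - row3 q 0 0).
  by rewrite divgB divg_row3 qE !raddf0 !addr0 subrr.
have r1 : Oh_at0 (v - polymap F) D.+1.
  by apply: (vanishing_partials_Oh oU U0 rU) => s; rewrite ltnS; exact: FE.
have r2 : Oh_at0 (polymap (row3 q 0 0)) D.+1.
  by apply: polymap_Oh; apply: ord3P; rewrite mxE //=; exact: order_ge0.
have [C [e [e0 h]]] := Oh_at0D r1 r2; exists C, e; split => // x xe.
by have := h x xe; rewrite polymapB opprB addrA addrAC.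
Qed.

Lemma app_tr (A : 'M[R]_3) x : app A^T x = x *m A.
Proof. by rewrite /app trmx_mul !trmxK. Qed.

Lemma norm_mulmx_row (A : 'M[R]_3) x (C : R) : 0 <= C -> (forall i j, `|A i j| <= C) ->
  `|x *m A| <= 3 * C * `|x|.
Proof.
move=> C0 AC; apply: norm_row_le => [|j]; first by rewrite !mulr_ge0.
rewrite mxE; apply: le_trans (ler_norm_sum _ _ _) _.
have -> : 3 * C * `|x| = \sum_(i < 3) `|x| * C.
  by rewrite sumr_const card_ord; ring.
by apply: ler_sum => i _; rewrite normrM ler_pM // coord_le_norm.
Qed.

Lemma app_Nmat x : app (Nmat R) x = polymap (shift_field R) x.
Proof.
apply/rowP; apply: ord3P; rewrite polymapE !mxE sum_ord3 !mxE /= /peval ?mevalXU ?meval0;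
  by rewrite !(mul0r, mul1r, add0r, addr0).
Qed.

Lemma mpoly2_of_mpoly3 (p : T) : mderiv i2 p = 0 -> order_ge 2 p ->
  exists2 q : mpoly.mpoly 2 R,
    (forall m, (mpoly.mdeg m < 2)%N -> mpoly.mcoeff m q = 0) &
    forall x, eval12 q x = peval p x.
Proof.
move=> dp p2.
pose w : 'I_2 -> 'I_3 := widen_ord (leqnSn 2).
pose r (m : multinom 3) : multinom 2 := Multinom [tuple m (w i) | i < 2].
have rE m i : r m i = m (w i) by rewrite /fun_of_multinom /= tnth_mktuple.
have sum2 (V : nmodType) (F : 'I_3 -> V) : \sum_(i < 3) F i = \sum_(i < 2) F (w i) + F i2.
  by rewrite big_ord_recr /=; congr (_ + F _); exact: val_inj.
exists (\sum_(m <- msupp p) mcoeff m p *: mpolyX R (r m)) => [m m2|x].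
  rewrite (raddf_sum (mcoeff m)) big_seq big1 // => m' m'p /=.
  rewrite mcoeffZ mcoeffX; case: eqP => [rm|_]; last by rewrite mulr0.
  have m'2 : m' i2 = 0%N by apply: (mderiv_eq0 dp); rewrite -mcoeff_msupp.
  rewrite p2 ?mul0r // mdegE sum2 m'2 addr0.
  by move: m2; rewrite -rm mdegE (eq_bigr _ (fun i _ => rE m' i)).
rewrite /eval12 /peval [in RHS](mpolyE p) (raddf_sum (meval _)) [RHS](raddf_sum (meval _)) big_seq [RHS]big_seq.
apply: eq_bigr => m mp /=; rewrite !mevalZ !mevalX; congr (_ * _).
have m2 : m i2 = 0%N by apply: (mderiv_eq0 dp); rewrite -mcoeff_msupp.
rewrite [RHS]big_ord_recr /= (_ : ord_max = i2) ?m2 ?mulr1; last exact: val_inj.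
by apply: eq_bigr => i _; rewrite rE.
Qed.

End OhEstimates.

(** * From the polynomial field back to the smooth one *)

Lemma polymap_order1_at0 (R : realType) (F : 'rV[mpoly 3 R]_3) :
  (forall i, order_ge 1 (F 0 i)) -> polymap F 0 = 0.
Proof. by move=> F1; apply/rowP => i; rewrite polymapE peval0 F1 ?mdeg0 ?mxE. Qed.

(** Used with [r] the Taylor remainder and [J] the Jacobian of the change of coordinates: [Phi] is
    at most linear in size near 0 and [J] is bounded there, so the order survives. *)
Lemma push_remainder_Oh (R : realType) k (J : 'M[mpoly 3 R]_3) (Phi : 'rV[mpoly 3 R]_3)
    (r : 'rV[R]_3 -> 'rV[R]_3) :
  (forall i, order_ge 1 (Phi 0 i)) -> Oh_at0 r k ->
  Oh_at0 (fun y => r (polymap Phi y) *m map_mx (fun p => peval p (polymap Phi y)) J) k.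
Proof.
move=> Phi1 [C [e [e0 rC]]].
have [A A0 PhiA] := polymap_bound Phi1.
have [B B0 JB] : exists2 B : R, 0 <= B &
    forall x, `|x| <= 1 -> forall i j, `|peval (J i j) x| <= B.
  have row i : exists2 B : R, 0 <= B & forall x, `|x| <= 1 -> forall j, `|peval (J i j) x| <= B.
    have [B B0 h] := @polymap_bound R (row i J) 0 (fun j => @order_ge_any _ _ _).
    exists B => // x x1 j; have := h x x1; rewrite expr0 mulr1; apply: le_trans.
    by have := coord_le_norm (polymap (row i J) x) j; rewrite polymapE mxE.
  have [B0 B00 h0] := row i0; have [B1 B10 h1] := row i1; have [B2 B20 h2] := row i2.
  exists (B0 + B1 + B2); first by rewrite !addr_ge0.
  move=> x x1; apply: ord3P => j.
  - by apply: le_trans (h0 x x1 j) _; lra.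
  - by apply: le_trans (h1 x x1 j) _; lra.
  - by apply: le_trans (h2 x x1 j) _; lra.
have A1 : 0 < A + 1 by rewrite ltr_wpDl.
(* The radius keeps [polymap Phi y] within both the unit ball and the domain of the estimate on [r];
   dividing by [A + 1] allows [A = 0]. *)
exists (3 * B * (`|C| * A ^+ k)), (Num.min 1 (Num.min 1 e / (A + 1))); split.
  by rewrite lt_min ltr01 divr_gt0 // lt_min ltr01.
move=> y; rewrite lt_min ltr_pdivlMr // => /andP[y1 ye].
have yA : `|polymap Phi y| <= A * `|y| by have := PhiA y (ltW y1); rewrite expr1.
have : `|polymap Phi y| < Num.min 1 e.
  apply: le_lt_trans yA (le_lt_trans _ ye).
  by rewrite mulrC ler_wpM2l // lerDl.
rewrite lt_min => /andP[x1 xe].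
apply: le_trans (norm_mulmx_row _ B0 _) _.
  by move=> i j; rewrite mxE; apply: JB; exact: ltW.
rewrite -!mulrA ler_wpM2l // ler_wpM2l //.
apply: le_trans (rC _ xe) _.
apply: (@le_trans _ _ (`|C| * `|polymap Phi y| ^+ k)).
  by apply: ler_wpM2r; [exact: exprn_ge0 | exact: ler_norm].
apply: ler_wpM2l => //; rewrite -exprMn.
by apply: lerXn2r => //; rewrite nnegrE ?mulr_ge0.
Qed.

Unset Implicit Arguments.

Theorem theorem1 (R : realType) (U : set 'rV[R]_3) (v : 'rV[R]_3 -> 'rV[R]_3) :
  open U -> U 0 -> smooth_on U v ->
  (forall x, U x -> divergence v x = 0) ->
  Oh_at0 (fun x => v x - app (Nmat R) x) 2 ->
  forall D : nat, (2 <= D)%N ->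
  exists (psi phi : 'rV[R]_3 -> 'rV[R]_3) (V W : set 'rV[R]_3) (p : mpoly.mpoly 2 R),
    [/\ open V, V 0, V `<=` U, open W & W 0] /\
    smooth_on V psi /\
    (forall x, V x -> W (psi x) /\ phi (psi x) = x) /\
    (forall y, W y -> V (phi y) /\ psi (phi y) = y) /\
    (forall x, V x -> \det (jacmx psi x) = 1) /\
    Oh_at0 (fun x => psi x - x) 2 /\
    (forall m : mpoly.multinom 2, (mpoly.mdeg m < 2)%N -> mpoly.mcoeff m p = 0) /\
    Oh_at0 (fun eta => app (jacmx psi (phi eta)) (v (phi eta))
                      - app (Nmat R) eta - eval12 p eta *: ev R (@Ordinal 3 2 isT)) D.+1.
Proof.
move=> oU U0 vU divv vN D D2.
have [P divP vP] := divfree_taylor D oU U0 vU divv.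
(* Both [v - N] and [v - P] are O(|x|^2), the latter because D + 1 >= 2. *)
have P2 i : order_ge 2 (P 0 i - shift_field R 0 i).
  rewrite -row_subE; apply: Oh_order_ge2.
  have [C [e [e0 h]]] := Oh_at0D vN (Oh_at0N (Oh_at0W (leqW D2) vP)).
  exists C, e; split => // x /h; rewrite polymapB app_Nmat.
  by rewrite opprB addrC subrKA.
have [Psi [Phi [Q [p [[l r dt nid inv1 push _] p2 dp QN]]]]] :=
  polynomial_normal_form (leqW D2) P2 divP.
have phipsi x : polymap Phi (polymap Psi x) = x by rewrite -polymap_comp l polymap_idmap.
have psiphi y : polymap Psi (polymap Phi y) = y by rewrite -polymap_comp r polymap_idmap.
have [q q2 qE] := mpoly2_of_mpoly3 dp p2.
(* The automorphisms are global, so the domain need not shrink: [V] is [U] itself and [W] is its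
   image, written as a preimage under the inverse. *)
exists (polymap Psi), (polymap Phi), U, (polymap Phi @^-1` U), q.
split; first split => //.
- by apply: open_comp => // x _; exact: continuous_polymap.
- by rewrite /= polymap_order1_at0.
split; first exact: smooth_polymap.
split; first by move=> x Ux /=; rewrite phipsi.
split; first by move=> y.
split.
  move=> x _; rewrite jacmx_polymap det_tr.
  by rewrite (det_map_mx (meval (fun i => x 0 i))) dt rmorph1.
split.
  have [C [e [e0 h]]] : Oh_at0 (polymap (Psi - idmap R 3)) 2.
    by apply: polymap_Oh => i; rewrite row_subE.
  by exists C, e; split => // x /h; rewrite polymapB polymap_idmap.
split => //.
(* The pushforward is linear in the field: that of [P] is exactly [Q], so the error is the
   transported Taylor remainder plus the distance of [Q] from its normal form. *)
have [C [e [e0 h]]] := Oh_at0D (push_remainder_Oh (jactr Psi) inv1 vP) (polymap_Oh QN).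
exists C, e; split => // y /h; congr (`| _ | <= _).
rewrite jacmx_polymap app_tr app_Nmat qE !polymapB.
set x := polymap Phi y; set J := map_mx _ _.
have pushE : polymap P x *m J = polymap Q y.
  rewrite -(psiphi y) -polymap_comp -push /polymap /J.
  by rewrite (map_mxM (meval (fun i => x 0 i))).
have -> : polymap (row3 0 0 p) y = peval p y *: ev R (@Ordinal 3 2 isT).
  apply/rowP; apply: ord3P; rewrite polymapE !mxE /= ?mulr0 ?mulr1 // /peval ?meval0 //.
by rewrite mulmxBl pushE addrA addrA subrK.
Qed.
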